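(* Let $(M,g)$ be an oriented smooth Riemannian surface with Gauss curvature $K$, and let $\mathrm{g}_{f,a,h}$ be a positive definite ciconia metric on $T_M$ (so $f,h$ are real, $f>0$ and $fh-|a|^2>0$) such that each of the weight functions $f,a,h$ belongs to one of the two classes $C^\infty_{M,\pi}$, $C^\infty_{r^2}$. Suppose $\mathrm{g}_{f,a,h}$ is Kähler. Then: (i) if $f,a,h\in C^\infty_{M,\pi}$, then $K=0$, $a$ is holomorphic and $h$ is constant; (ii) if $f,h\in C^\infty_{M,\pi}$ and $a\in C^\infty_{r^2}$, then $K=0$ and $a,h$ are constant; (iii) if $f,a\in C^\infty_{M,\pi}$ and $h\in C^\infty_{r^2}$, then $K=0$ and $a$ is holomorphic; (iv) if $a,h\in C^\infty_{M,\pi}$ and $f\in C^\infty_{r^2}$, then $f(r^2)=f_1r^2+f_0$, $K=-\frac{2f_1}{h}$, where $h,f_0,f_1$ are constant, and $a$ is holomorphic; (v) if $f\in C^\infty_{M,\pi}$ and $a,h\in C^\infty_{r^2}$, then $K=0$ and $a$ is constant; (vi) if $a\in C^\infty_{M,\pi}$ and $f,h\in C^\infty_{r^2}$, then $K=-\frac{2f'}{h}$ and $a$ is holomorphic; (vii) if $h\in C^\infty_{M,\pi}$ and $f,a\in C^\infty_{r^2}$, then $f(r^2)=f_1r^2+f_0$, $K=-\frac{2f_1}{h}$, where $a,h,f_0,f_1$ are constant; (viii) if $f,a,h\in C^\infty_{r^2}$, then $K=-\frac{2f'}{h}$ and $a$ is constant. Conversely, if $f,a,h$ lie in the classes named in one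 of the cases (i)–(viii) and satisfy the conditions concluded in that case, then the metric $\mathrm{g}_{f,a,h}$ is Kähler.
   Context: Let $\pi:T_M\to M$ be the total space of the tangent bundle. $M$ carries the complex structure given by $g$ and the orientation. In a local holomorphic (isothermal) coordinate $z=x+iy$ on an open $\mathcal U\subset M$ write $g=\lambda\,dz\,d\bar z=\frac{\lambda}{2}(dz\otimes d\bar z+d\bar z\otimes dz)$ with $\lambda>0$ smooth, and $\Gamma=\frac1\lambda\frac{\partial\lambda}{\partial z}$; the Gauss curvature is $K=-\frac2\lambda\frac{\partial^2\log\lambda}{\partial z\partial\bar z}$. Identifying $T_zM$ with $T^{1,0}_zM=\mathbb{C}\partial_z$ via $\partial_x\mapsto\partial_z$, $\partial_y\mapsto i\partial_z$, one gets coordinates $(z,w)$ on $\pi^{-1}(\mathcal U)\cong\mathcal U\times\mathbb{C}$ ($w$ corresponds to $w\partial_z$); these are holomorphic charts making $T_M$ a complex surface. Put $\eta=dw+w\Gamma\,dz$ and $r^2(u)=g(u,u)=\lambda|w|^2$ for $u\in T_M$. For smooth $f,h:T_M\to\mathbb{R}$, $a:T_M\to\mathbb{C}$ with $fh-|a|^2\neq0$, the ciconia metric is the globally well-defined tensor $$\mathrm{g}_{f,a,h}=\tfrac{\lambda}{2}\big(f\,dz\cdot d\bar z+a\,dz\cdot\bar\eta+\bar a\,\eta\cdot d\bar z+h\,\eta\cdot\bar\eta\big),\qquad \alpha\cdot\beta=\alpha\otimes\beta+\beta\otimes\alpha,$$ which is compatible with the complex structure, with associated 2-form $$\omega_{f,a,h}=\tfrac{i\lambda}{2}\big(f\,dz\wedge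 d\bar z+a\,dz\wedge\bar\eta+\bar a\,\eta\wedge d\bar z+h\,\eta\wedge\bar\eta\big).$$ It is Kähler if it is positive definite and $d\omega_{f,a,h}=0$. $C^\infty_{M,\pi}$ is the set of smooth $\mathbb{C}$-valued functions on $T_M$ that are pullbacks by $\pi$ of functions on $M$; such a function is called holomorphic if it is the pullback of a holomorphic function on $M$. $C^\infty_{r^2}$ is the set of $\mathbb{C}$-valued functions on $T_M$ of the form $\varphi(r^2)$ with $\varphi:[0,+\infty)\to\mathbb{C}$ smooth (with derivatives of all orders at $0$); $\varphi'$ denotes the derivative with respect to $r^2$. *)

(* Defs.v *)
From HB Require Import structures.
From mathcomp Require Import all_boot all_order all_algebra.
From mathcomp Require Import all_classical all_reals all_analysis.
From mathcomp Require Export complex.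

Set Implicit Arguments.
Unset Strict Implicit.
Unset Printing Implicit Defensive.

Import Order.TTheory GRing.Theory Num.Theory.
Import numFieldNormedType.Exports.

Local Open Scope classical_set_scope.
Local Open Scope ring_scope.
Local Open Scope complex_scope.

(** * Smooth functions *)

Section Smooth.
Context {R : realType} {V : normedModType R}.
Implicit Types (D : set V) (F : V -> R[i]) (x : V).

Definition iterD (vs : seq V) (f : V -> R) : V -> R :=
  foldr (fun v g => 'D_v g) f vs.

(* C^infinity on an open set [D]: every iterated directional derivative is
   differentiable, hence continuous, on [D]. *)
Definition smooth_on D (f : V -> R) : Prop :=
  forall vs x, D x -> differentiable (iterD vs f) x.

Definition csmooth_on D F : Prop :=
  smooth_on D (fun x => complex.Re (F x)) /\
  smooth_on D (fun x => complex.Im (F x)).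

(* Derivative of a complex-valued function along a real direction. *)
Definition cderive (v : V) F x : R[i] :=
  'D_v (fun y => complex.Re (F y)) x +i* 'D_v (fun y => complex.Im (F y)) x.

(* Exterior derivative of the 2-form [w] on an open subset of [V], evaluated on
   constant vector fields (their brackets vanish, so that only the derivative
   terms of the invariant formula remain). *)
Definition ext_deriv2 (w : V -> V -> V -> R[i]) x (X Y Z : V) : R[i] :=
  cderive X (fun y => w y Y Z) x - cderive Y (fun y => w y X Z) x
  + cderive Z (fun y => w y X Y) x.

End Smooth.

(** * Calculus on the half line [0, +oo[ *)

Section HalfLine.
Context {R : realType}.

Definition half_quotient (phi : R -> R) (t : R) : R -> R :=
  fun s => (s - t)^-1 * (phi s - phi t).

Definition half_nbhs (t : R) : set_system R :=
  within [set s : R | 0 <= s] t^'.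

(* Derivative at [t >= 0] within [0, +oo[: one-sided at 0. *)
Definition half_derive (phi : R -> R) (t : R) : R :=
  lim (half_quotient phi t @ half_nbhs t).

Definition half_smooth (phi : R -> R) : Prop :=
  forall n t, 0 <= t ->
    cvg (half_quotient (iter n half_derive phi) t @ half_nbhs t).

Definition half_csmooth (phi : R -> R[i]) : Prop :=
  half_smooth (fun t => complex.Re (phi t)) /\
  half_smooth (fun t => complex.Im (phi t)).

Definition half_cderive (phi : R -> R[i]) (t : R) : R[i] :=
  half_derive (fun s => complex.Re (phi s)) t
  +i* half_derive (fun s => complex.Im (phi s)) t.

End HalfLine.

(** * Wirtinger calculus on R^2, identified with C by (x, y) |-> x + i y *)

Section Wirtinger.
Context {R : realType}.

Definition imag_unit : R[i] := 0 +i* 1.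

Definition cplx (v : R * R) : R[i] := v.1 +i* v.2.

Definition d_z (F : R * R -> R[i]) (z : R * R) : R[i] :=
  (cderive (1 : R, 0 : R) F z - imag_unit * cderive (0 : R, 1 : R) F z) / 2%:R.

Definition d_zbar (F : R * R -> R[i]) (z : R * R) : R[i] :=
  (cderive (1 : R, 0 : R) F z + imag_unit * cderive (0 : R, 1 : R) F z) / 2%:R.

End Wirtinger.

(** * Oriented smooth surfaces *)

Record chart (R : realType) (T : topologicalType) := Chart {
  dom : set T;
  coord : T -> R * R;
  param : R * R -> T;
  dom_open : open dom;
  img_open : open (coord @` dom);
  coord_continuous : {within dom, continuous coord};
  param_continuous : {within coord @` dom, continuous param};
  coordK : forall p, dom p -> param (coord p) = p
}.

Section Charts.
Context {R : realType} {T : topologicalType}.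
Implicit Types c : chart R T.

Definition img c : set (R * R) := coord c @` dom c.

Definition overlap c c' : set (R * R) := coord c @` (dom c `&` dom c').

Definition transition c c' : R * R -> R * R := coord c' \o param c.

Definition oriented_transition c c' : Prop :=
  [/\ smooth_on (overlap c c') (fun z => (transition c c' z).1),
      smooth_on (overlap c c') (fun z => (transition c c' z).2)
    & forall z, overlap c c' z ->
      let u := 'd (transition c c') z (1, 0) in
      let v := 'd (transition c c') z (0, 1) in
      0 < u.1 * v.2 - u.2 * v.1].

End Charts.

(* As usual, manifolds are Hausdorff and second countable; surfaces are
   connected. The smooth oriented structure is a maximal oriented atlas. *)
Record oriented_surface (R : realType) := OrientedSurface {
  carrier :> topologicalType;
  surface_hausdorff : hausdorff_space carrier;
  surface_second_countable : @second_countable carrier;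
  surface_connected : connected [set: carrier];
  atlas : set (chart R carrier);
  atlas_cover : forall p, exists2 c, atlas c & dom c p;
  atlas_compatible : forall c c', atlas c -> atlas c' ->
    oriented_transition c c';
  atlas_maximal : forall c,
    (forall c', atlas c' ->
       oriented_transition c c' /\ oriented_transition c' c) -> atlas c
}.

(** * The total space of the tangent bundle *)

Section Tangent.
Context {R : realType}.
Variable S : oriented_surface R.
Implicit Types c : chart R S.

Definition chart_at c (p : S) : Prop := atlas c /\ dom c p.

(* A tangent vector at [base] is a family of components, one pair for each
   chart at [base], which transform by the differentials of the transition maps.
   The irrelevant components are set to 0 so that equal vectors are equal. *)
Record tangent := Tangent {
  base : S;
  comp : chart R S -> R * R;
  comp_transition : forall c c', chart_at c base -> chart_at c' base ->
    comp c' = 'd (transition c c') (coord c base) (comp c);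
  comp_out : forall c, ~ chart_at c base -> comp c = 0
}.

Lemma nbhs_overlap c c' p : dom c p -> dom c' p ->
  nbhs (coord c p) (overlap c c').
Proof.
move=> cp c'p.
have ip : img c (coord c p) by exists p.
have /subspace_continuousP/(_ _ ip) hc := @param_continuous _ _ c.
have nd : nbhs (param c (coord c p)) (dom c').
  by rewrite coordK//; exact: (open_nbhs_nbhs (conj (dom_open c') c'p)).
have nI : nbhs (coord c p) (img c).
  by have := open_nbhs_nbhs (conj (@img_open _ _ c) ip); apply.
have nw : nbhs (coord c p) [set z | img c z -> dom c' (param c z)].
  exact: (hc _ nd).
near=> z.
have iz : img c z by near: z; exact: nI.
have c'z : dom c' (param c z) by move: iz; near: z; exact: nw.
case: iz => q cq qz.
exists q => //; split=> //.
by move: c'z; rewrite -qz coordK.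
Unshelve. all: by end_near. Qed.

Lemma transition_differentiable c c' p : chart_at c p -> chart_at c' p ->
  differentiable (transition c c') (coord c p).
Proof.
move=> [ac cp] [ac' c'p].
have oz : overlap c c' (coord c p) by exists p.
have [s1 s2 _] := atlas_compatible ac ac'.
have := differentiable_pair (s1 [::] _ oz) (s2 [::] _ oz).
rewrite (_ : (fun _ => _) = transition c c')//.
by apply/funext => z /=; case: (transition c c' z).
Qed.

Lemma near_eq_diff (f g : R * R -> R * R) z :
  {near z, f =1 g} -> differentiable f z -> differentiable g z ->
  'd f z = 'd g z :> (R * R -> R * R).
Proof.
move=> fg df dg; apply/funext => v.
have ef := deriveE v df; have eg := deriveE v dg.
have efg := near_eq_derive v fg.
apply: etrans (esym ef) _.
by apply: etrans efg _.
Qed.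

Lemma diff_transition c0 c c' p v :
  chart_at c0 p -> chart_at c p -> chart_at c' p ->
  'd (transition c0 c') (coord c0 p) v =
  'd (transition c c') (coord c p) ('d (transition c0 c) (coord c0 p) v).
Proof.
move=> h0 h h'.
have tp : transition c0 c (coord c0 p) = coord c p.
  by rewrite /transition /= coordK//; case: h0.
have d0 := transition_differentiable h0 h.
have d1 : differentiable (transition c c') (transition c0 c (coord c0 p)).
  by rewrite tp; exact: transition_differentiable.
have nz : {near coord c0 p,
    transition c0 c' =1 transition c c' \o transition c0 c}.
  near=> z.
  have : overlap c0 c z by near: z; apply: nbhs_overlap; [case: h0|case: h].
  by move=> [q [q0 q1] <-]; rewrite /transition /= !coordK.
have e1 := near_eq_diff nz (transition_differentiable h0 h')
  (differentiable_comp d0 d1).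
have e2 := diff_comp d0 d1.
apply: etrans (congr1 (fun F => F v) e1) _.
apply: etrans (congr1 (fun F => F v) e2) _.
by rewrite /= tp.
Unshelve. all: by end_near. Qed.

(* The inverse of the bundle chart [u |-> (coord c (base u), comp u c)] induced
   by [c], defined on [img c `*` setT]. *)
Section Lift.
Variables (c : chart R S) (z v : R * R).

Definition lift_comp (c' : chart R S) : R * R :=
  if `[< [/\ atlas c, img c z & chart_at c' (param c z)] >]
  then 'd (transition c c') z v else 0.

Lemma lift_transition c1 c2 :
  chart_at c1 (param c z) -> chart_at c2 (param c z) ->
  lift_comp c2 = 'd (transition c1 c2) (coord c1 (param c z)) (lift_comp c1).
Proof.
move=> h1 h2; rewrite /lift_comp.
have [ac|nac] := pselect (atlas c); last first.
  by rewrite !asboolF ?linear0// => -[].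
have [[p cp pz]|nz] := pselect (img c z); last first.
  by rewrite !asboolF ?linear0// => -[].
have hc : img c z by exists p.
rewrite !asboolT//; move: h1 h2.
by rewrite -pz coordK// => h1 h2; apply: diff_transition.
Qed.

Lemma lift_out c' : ~ chart_at c' (param c z) -> lift_comp c' = 0.
Proof. by move=> h; rewrite /lift_comp asboolF// => -[]. Qed.

Definition lift : tangent := Tangent lift_transition lift_out.

End Lift.

Definition smooth_TM (F : tangent -> R[i]) : Prop :=
  forall c, atlas c ->
    csmooth_on (img c `*` setT) (fun q => F (lift c q.1 q.2)).

(* The class C^oo_{M,pi}. *)
Definition basic (F : tangent -> R[i]) : Prop :=
  smooth_TM F /\ exists F0 : S -> R[i], forall u, F u = F0 (base u).

End Tangent.

(** * Oriented Riemannian surfaces *)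

Definition symm_form {R : realType} (E F G : R) (v w : R * R) : R :=
  E * v.1 * w.1 + F * (v.1 * w.2 + v.2 * w.1) + G * v.2 * w.2.

Section Metric.
Context {R : realType} {T : topologicalType}.
Variables E F G : chart R T -> R * R -> R.

Definition metric_form (c : chart R T) (z v w : R * R) : R :=
  symm_form (E c z) (F c z) (G c z) v w.

Definition conformal (c : chart R T) : Prop :=
  forall z, img c z -> E c z = G c z /\ F c z = 0.

End Metric.

(* An oriented surface with a Riemannian metric
   E dx^2 + 2 F dx dy + G dy^2. The last field says that the positively oriented
   isothermal coordinates cover the surface, i.e. that the surface carries the
   complex structure given by the metric and the orientation; every oriented
   Riemannian surface has this property, by the theorem of Gauss, Korn and
   Lichtenstein. *)
Record riemannian_surface (R : realType) := RiemannianSurface {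
  surface :> oriented_surface R;
  gE : chart R surface -> R * R -> R;
  gF : chart R surface -> R * R -> R;
  gG : chart R surface -> R * R -> R;
  metric_smooth : forall c, atlas c ->
    [/\ smooth_on (img c) (gE c), smooth_on (img c) (gF c)
      & smooth_on (img c) (gG c)];
  metric_gt0 : forall c z v, atlas c -> img c z -> v != 0 ->
    0 < metric_form gE gF gG c z v v;
  metric_invariant : forall c c' z v w, atlas c -> atlas c' ->
    overlap c c' z ->
    metric_form gE gF gG c' (transition c c' z)
      ('d (transition c c') z v) ('d (transition c c') z w)
    = metric_form gE gF gG c z v w;
  isothermal_cover : forall p, exists c,
    [/\ atlas c, dom c p & conformal gE gF gG c]
}.

Section Riemannian.
Context {R : realType}.
Variable S : riemannian_surface R.
Implicit Types (c : chart R S) (z : R * R) (f h : tangent S -> R)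
  (a : tangent S -> R[i]).

Definition isothermal c : Prop :=
  atlas c /\ conformal (@gE _ S) (@gF _ S) (@gG _ S) c.

(* g = lambda dz dzbar = lambda (dx^2 + dy^2) in an isothermal chart. *)
Definition lambda c z : R := gE c z.

Definition Gam c z : R[i] :=
  ((lambda c z)^-1)%:C * d_z (fun z' => (lambda c z')%:C) z.

Definition gauss_curvature (K : S -> R) : Prop :=
  forall c p, isothermal c -> dom c p ->
    (K p)%:C = - (2%:R / lambda c (coord c p))%:C *
      d_z (d_zbar (fun z => (ln (lambda c z))%:C)) (coord c p).

(* r^2(u) = g(u, u); the value does not depend on the chart. *)
Definition r2 (u : tangent S) : R :=
  let c := projT1 (cid2 (atlas_cover (base u))) in
  metric_form (@gE _ S) (@gF _ S) (@gG _ S) c (coord c (base u))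
    (comp u c) (comp u c).

(* [F = phi(r^2)] with [phi] smooth on [0, +oo[. *)
Definition radial_by (phi : R -> R[i]) (F : tangent S -> R[i]) : Prop :=
  half_csmooth phi /\ forall u, F u = phi (r2 u).

(* The class C^oo_{r^2}. *)
Definition radial (F : tangent S -> R[i]) : Prop :=
  exists phi, radial_by phi F.

Definition holomorphic (F0 : S -> R[i]) : Prop :=
  forall c, isothermal c ->
    csmooth_on (img c) (F0 \o param c) /\
    forall z, img c z -> d_zbar (F0 \o param c) z = 0.

Definition holomorphic_TM (F : tangent S -> R[i]) : Prop :=
  exists2 F0 : S -> R[i], holomorphic F0 & forall u, F u = F0 (base u).

(** The ciconia metric, in the coordinates (z, w) of the bundle chart induced by
    an isothermal chart. *)

Definition TMcoord : Type := (R * R) * (R * R).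

Definition form_dz (V : TMcoord) : R[i] := cplx V.1.

Definition form_dw (V : TMcoord) : R[i] := cplx V.2.

Definition form_eta c (q V : TMcoord) : R[i] :=
  form_dw V + cplx q.2 * Gam c q.1 * form_dz V.

Definition form_conj (al : TMcoord -> R[i]) (V : TMcoord) : R[i] := conjc (al V).

Definition sym_prod (al be : TMcoord -> R[i]) (V W : TMcoord) : R[i] :=
  al V * be W + be V * al W.

Definition wedge (al be : TMcoord -> R[i]) (V W : TMcoord) : R[i] :=
  al V * be W - be V * al W.

Definition ciconia f a h c (q V W : TMcoord) : R[i] :=
  let u := lift c q.1 q.2 in
  let dz := form_dz in
  let eta := form_eta c q in
  (lambda c q.1)%:C / 2%:R *
  ((f u)%:C * sym_prod dz (form_conj dz) V W
   + a u * sym_prod dz (form_conj eta) V W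
   + conjc (a u) * sym_prod eta (form_conj dz) V W
   + (h u)%:C * sym_prod eta (form_conj eta) V W).

Definition ciconia_form f a h c (q V W : TMcoord) : R[i] :=
  let u := lift c q.1 q.2 in
  let dz := form_dz in
  let eta := form_eta c q in
  imag_unit * (lambda c q.1)%:C / 2%:R *
  ((f u)%:C * wedge dz (form_conj dz) V W
   + a u * wedge dz (form_conj eta) V W
   + conjc (a u) * wedge eta (form_conj dz) V W
   + (h u)%:C * wedge eta (form_conj eta) V W).

(* The order on [R[i]] makes [0 < x] say that [x] is real and positive. *)
Definition ciconia_posdef f a h : Prop :=
  forall c q V, isothermal c -> img c q.1 -> V != 0 ->
    0 < ciconia f a h c q V V.

Definition ciconia_kahler f a h : Prop :=
  ciconia_posdef f a h /\
  forall c q, isothermal c -> img c q.1 ->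
    forall X Y Z, ext_deriv2 (ciconia_form f a h c) q X Y Z = 0.

End Riemannian.

Definition constant_fun (X Y : Type) (F : X -> Y) : Prop :=
  exists y, forall x, F x = y.

(* A real-valued function, regarded as a complex-valued one. *)
Definition complexify (R : realType) (X : Type) (f : X -> R) : X -> R[i] :=
  fun x => (f x)%:C.

(* Main.v *)
From HB Require Import structures.
Require Import Defs.
From mathcomp Require Import all_boot all_order all_algebra.
From mathcomp Require Import all_classical all_reals all_analysis.
From mathcomp Require Import ring lra.

Set Implicit Arguments.
Unset Strict Implicit.
Unset Printing Implicit Defensive.

Import Order.TTheory GRing.Theory Num.Theory.
Import numFieldNormedType.Exports.

Local Open Scope classical_set_scope.
Local Open Scope ring_scope.
Local Open Scope complex_scope.

(** Let F_1, F_1bar, F_2, F_2bar be the components of dF in the coframe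
    (dz, dzbar, eta, etabar) of an isothermal bundle chart: F_2 = dF/dw and
    F_1 = dF/dz - w Gam dF/dw. The structure equations are
    d lambda = lambda (Gam dz + Gambar dzbar) and
    d eta = Gam eta ^ dz + (lambda K / 2) w dz ^ dzbar, the latter because
    dGam/dzbar = - lambda K / 2 ([d_zbar_Gam]). They make lambda dz ^ dzbar,
    lambda dz ^ etabar and lambda eta ^ dzbar closed, while
    d (lambda eta ^ etabar) =
      (lambda^2 K / 2) (w dz ^ dzbar ^ etabar + wbar dz ^ dzbar ^ eta).
    Hence the form of the metric is closed if and only if
<<
      h_1 = a_2                                    (component dz eta etabar)
      f_2 = conj (a_1bar) - wbar lambda K h / 2    (component dz dzbar eta)
>>
    the other two components being conjugate to these
    ([ext_deriv2_hermitian_form], [three_forms_eq0], [kahler_equations]).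

    A pullback F has F_2 = 0 and F_1 = dF/dz ([frame_fst]). The horizontal
    derivatives kill r^2 = lambda w wbar, so phi(r^2) has F_1 = F_1bar = 0 and
    F_2 = phi'(r^2) lambda wbar ([frame_radial]). For each choice of classes the
    two equations are therefore explicit in w. On the zero section w = 0 only
    the horizontal derivatives of pullbacks survive: this makes h constant when
    it is a pullback (as M is connected) and a holomorphic when it is one. What
    remains is a_2 = 0, which makes a constant when it is a function of r^2, and
    f_2 = - wbar lambda K h / 2, that is K = 0 when f is a pullback and
    K = - 2 f' / h when f is a function of r^2. The last identity is
    obtained off the zero section and extends to it by continuity; when h is
    constant it forces f' to be constant, so f is affine in r^2. All these steps
    are reversible. *)

(** * Derivatives of complex-valued functions *)

Lemma complex_ext (R : realType) (x y : R[i]) :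
  complex.Re x = complex.Re y -> complex.Im x = complex.Im y -> x = y.
Proof. by case: x => a b; case: y => c d /= -> ->. Qed.

Lemma Re_addc (R : realType) (x y : R[i]) :
  complex.Re (x + y) = complex.Re x + complex.Re y.
Proof. by case: x; case: y. Qed.

Lemma Im_addc (R : realType) (x y : R[i]) :
  complex.Im (x + y) = complex.Im x + complex.Im y.
Proof. by case: x; case: y. Qed.

Lemma Re_mulc (R : realType) (x y : R[i]) :
  complex.Re (x * y) =
  complex.Re x * complex.Re y - complex.Im x * complex.Im y.
Proof. by case: x; case: y. Qed.

Lemma Im_mulc (R : realType) (x y : R[i]) :
  complex.Im (x * y) =
  complex.Re x * complex.Im y + complex.Im x * complex.Re y.
Proof. by case: x; case: y. Qed.

Section Conj.
Context {R : realType}.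
Implicit Types x y : R[i].

Lemma conjcD x y : conjc (x + y) = conjc x + conjc y.
Proof. exact: rmorphD. Qed.

Lemma conjcN x : conjc (- x) = - conjc x.
Proof. exact: rmorphN. Qed.

Lemma conjcM x y : conjc (x * y) = conjc x * conjc y.
Proof. exact: rmorphM. Qed.

End Conj.

Section RealRules.
Context {R : realType} {V : normedModType R}.
Implicit Types (f g p q : V -> R) (x v : V).

Lemma differentiable_mulB f g p q x :
  differentiable f x -> differentiable g x -> differentiable p x ->
  differentiable q x -> differentiable (fun y => f y * g y - p y * q y) x.
Proof. by move=> *; apply: differentiableB; apply: differentiableM. Qed.

Lemma differentiable_mulD f g p q x :
  differentiable f x -> differentiable g x -> differentiable p x ->
  differentiable q x -> differentiable (fun y => f y * g y + p y * q y) x.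
Proof. by move=> *; apply: differentiableD; apply: differentiableM. Qed.

Lemma derive_mul f g x v : differentiable f x -> differentiable g x ->
  'D_v (f * g) x = 'D_v f x * g x + f x * 'D_v g x.
Proof.
move=> /diff_derivable df /diff_derivable dg.
by rewrite deriveM// addrC [_ *: _]mulrC.
Qed.

Lemma derive_mulB f g p q x v :
  differentiable f x -> differentiable g x -> differentiable p x ->
  differentiable q x -> 'D_v (fun y => f y * g y - p y * q y) x =
    'D_v f x * g x + f x * 'D_v g x - ('D_v p x * q x + p x * 'D_v q x).
Proof.
move=> df dg dp dq.
by rewrite deriveB ?derive_mul//; apply: derivableM; exact: diff_derivable.
Qed.

Lemma derive_mulD f g p q x v :
  differentiable f x -> differentiable g x -> differentiable p x ->
  differentiable q x -> 'D_v (fun y => f y * g y + p y * q y) x =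
    'D_v f x * g x + f x * 'D_v g x + ('D_v p x * q x + p x * 'D_v q x).
Proof.
move=> df dg dp dq.
by rewrite deriveD ?derive_mul//; apply: derivableM; exact: diff_derivable.
Qed.

Lemma deriveDZ f (k : R) u v x : differentiable f x ->
  'D_(k *: u + v) f x = k * 'D_u f x + 'D_v f x.
Proof. by move=> df; rewrite !deriveE// linearP. Qed.

End RealRules.

Section ComplexCalculus.
Context {R : realType} {V : normedModType R}.
Implicit Types (F G : V -> R[i]) (x v : V).

Definition cdifferentiable F x : Prop :=
  differentiable (fun y => complex.Re (F y)) x /\
  differentiable (fun y => complex.Im (F y)) x.

(** Differentiability is bundled with the value of the derivative so that the
    derivative of a formula can be built by applying the rules below. *)
Definition is_cderive v F x (d : R[i]) : Prop :=
  cdifferentiable F x /\ cderive v F x = d.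

Lemma is_cderiveP v F x : cdifferentiable F x -> is_cderive v F x (cderive v F x).
Proof. by []. Qed.

Lemma is_cderive_eq v F x d d' : is_cderive v F x d -> d = d' -> is_cderive v F x d'.
Proof. by move=> ? <-. Qed.

Lemma is_cderive_cst v x (k : R[i]) : is_cderive v (fun=> k) x 0.
Proof.
split; first by split; exact: differentiable_cst.
by rewrite /cderive !derive_cst.
Qed.

Lemma is_cderiveD v F G x dF dG :
  is_cderive v F x dF -> is_cderive v G x dG ->
  is_cderive v (fun y => F y + G y) x (dF + dG).
Proof.
move=> [[rF iF] <-] [[rG iG] <-].
have eR : (fun y => complex.Re (F y + G y)) =
  (fun y => complex.Re (F y)) + (fun y => complex.Re (G y)).
  by apply/funext => y; rewrite raddfD.
have eI : (fun y => complex.Im (F y + G y)) =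
  (fun y => complex.Im (F y)) + (fun y => complex.Im (G y)).
  by apply/funext => y; rewrite raddfD.
rewrite /is_cderive /cdifferentiable /cderive eR eI.
split; first by split; exact: differentiableD.
by rewrite !deriveD//; exact: diff_derivable.
Qed.

Lemma is_cderiveN v F x dF :
  is_cderive v F x dF -> is_cderive v (fun y => - F y) x (- dF).
Proof.
move=> [[rF iF] <-].
have eR : (fun y => complex.Re (- F y)) = - (fun y => complex.Re (F y)).
  by apply/funext => y; rewrite raddfN.
have eI : (fun y => complex.Im (- F y)) = - (fun y => complex.Im (F y)).
  by apply/funext => y; rewrite raddfN.
rewrite /is_cderive /cdifferentiable /cderive eR eI.
split; first by split; exact: differentiableN.
by rewrite !deriveN//; exact: diff_derivable.
Qed.

Lemma is_cderiveB v F G x dF dG :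
  is_cderive v F x dF -> is_cderive v G x dG ->
  is_cderive v (fun y => F y - G y) x (dF - dG).
Proof. by move=> hF hG; apply: is_cderiveD => //; exact: is_cderiveN. Qed.

Lemma is_cderiveM v F G x dF dG :
  is_cderive v F x dF -> is_cderive v G x dG ->
  is_cderive v (fun y => F y * G y) x (dF * G x + F x * dG).
Proof.
move=> [[rF iF] <-] [[rG iG] <-].
have eR : (fun y => complex.Re (F y * G y)) = (fun y =>
    complex.Re (F y) * complex.Re (G y) - complex.Im (F y) * complex.Im (G y)).
  by apply/funext => y; exact: Re_mulc.
have eI : (fun y => complex.Im (F y * G y)) = (fun y =>
    complex.Re (F y) * complex.Im (G y) + complex.Im (F y) * complex.Re (G y)).
  by apply/funext => y; exact: Im_mulc.
split.
  split; [rewrite eR; exact: differentiable_mulB|].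
  by rewrite eI; exact: differentiable_mulD.
rewrite /cderive eR eI derive_mulB// derive_mulD//.
by apply: complex_ext; rewrite !(Re_addc, Im_addc, Re_mulc, Im_mulc) /=; ring.
Qed.

Lemma is_cderive_conj v F x dF :
  is_cderive v F x dF -> is_cderive v (fun y => conjc (F y)) x (conjc dF).
Proof.
move=> [[rF iF] <-].
have eR : (fun y => complex.Re (conjc (F y))) = (fun y => complex.Re (F y)).
  by apply/funext => y; case: (F y).
have eI : (fun y => complex.Im (conjc (F y))) = - (fun y => complex.Im (F y)).
  by apply/funext => y /=; rewrite /GRing.opp /=; case: (F y).
rewrite /is_cderive /cdifferentiable /cderive eR eI.
split; first by split=> //; exact: differentiableN.
by rewrite !deriveN//=; exact: diff_derivable.
Qed.

Lemma is_cderive_real v (f : V -> R) x : differentiable f x ->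
  is_cderive v (fun y => (f y)%:C) x ('D_v f x)%:C.
Proof.
move=> df; split; first by split=> //; exact: differentiable_cst.
by rewrite /cderive /= derive_cst.
Qed.

Lemma cderiveDZ (k : R) u v F x : cdifferentiable F x ->
  cderive (k *: u + v) F x = k%:C * cderive u F x + cderive v F x.
Proof.
move=> [dr di]; rewrite /cderive !deriveDZ//.
by apply: complex_ext; rewrite !(Re_addc, Im_addc, Re_mulc, Im_mulc) /=; ring.
Qed.

Lemma near_cderive v F G x : (\near x, F x = G x) -> cderive v F x = cderive v G x.
Proof.
move=> FG; have [->|v0] := eqVneq v 0; first by rewrite /cderive !derive0.
by rewrite /cderive; congr (_ +i* _); apply: near_eq_derive => //;
  near=> y; congr (_ _); near: y.
Unshelve. all: by end_near. Qed.

End ComplexCalculus.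

(** * Wirtinger derivatives on the total space *)

Section Wirtinger.
Context {R : realType}.
Local Notation TM := ((R * R) * (R * R))%type.
Implicit Types (F : TM -> R[i]) (q X : TM).

Definition e_x : TM := ((1, 0), (0, 0)).
Definition e_y : TM := ((0, 1), (0, 0)).
Definition e_u : TM := ((0, 0), (1, 0)).
Definition e_v : TM := ((0, 0), (0, 1)).

Definition pd_z F q : R[i] :=
  (cderive e_x F q - imag_unit * cderive e_y F q) / 2%:R.
Definition pd_zbar F q : R[i] :=
  (cderive e_x F q + imag_unit * cderive e_y F q) / 2%:R.
Definition pd_w F q : R[i] :=
  (cderive e_u F q - imag_unit * cderive e_v F q) / 2%:R.
Definition pd_wbar F q : R[i] :=
  (cderive e_u F q + imag_unit * cderive e_v F q) / 2%:R.

Lemma imag_unit2 : imag_unit * imag_unit = -1 :> R[i].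
Proof. by rewrite -(sqr_i R) expr2. Qed.

Lemma conj_imag_unit : conjc imag_unit = - imag_unit :> R[i].
Proof. by rewrite /imag_unit /=; congr (_ +i* _); rewrite oppr0. Qed.

Lemma cplxE (v : R * R) : cplx v = v.1%:C + imag_unit * v.2%:C.
Proof. exact: complexE. Qed.

Lemma conj_cplxE (v : R * R) : conjc (cplx v) = v.1%:C - imag_unit * v.2%:C.
Proof.
rewrite /imag_unit; apply/eqP; rewrite eq_complex /=.
by apply/andP; split; apply/eqP; ring.
Qed.

Lemma cplx_eq0 (v : R * R) : (cplx v == 0) = (v == 0).
Proof. by case: v => x y; rewrite eq_complex. Qed.

Lemma sqr_norm_gt0 (v : R * R) : v != 0 -> 0 < v.1 ^+ 2 + v.2 ^+ 2.
Proof.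
case: v => x y v0; rewrite lt_def addr_ge0 ?sqr_ge0// andbT.
by rewrite paddr_eq0 ?sqr_ge0// !sqrf_eq0.
Qed.

Lemma two_neq0 : 2%:R != 0 :> R[i].
Proof. by rewrite pnatr_eq0. Qed.

(** The two Wirtinger derivatives are the coefficients of the real differential
    with respect to v and conj v. *)
Lemma wirtinger_expand (V : normedModType R) (F : V -> R[i]) x (e e' : V) (v : R * R) :
  cdifferentiable F x ->
  cderive (v.1 *: e + v.2 *: e') F x =
  (cderive e F x - imag_unit * cderive e' F x) / 2%:R * cplx v
  + (cderive e F x + imag_unit * cderive e' F x) / 2%:R * conjc (cplx v).
Proof.
move=> dF; rewrite -[v.2 *: e']addr0 !cderiveDZ//.
have -> : cderive 0 F x = 0 by rewrite /cderive !derive0.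
rewrite conj_cplxE cplxE.
set i := imag_unit; have i2 : i * i = -1 := imag_unit2.
set p := cderive _ _ _; set r := cderive _ _ _.
move: v.1%:C v.2%:C => s t.
apply/eqP; rewrite -subr_eq0; apply/eqP.
(* The two sides differ by a multiple of 1 + i ^ 2. *)
transitivity (r * t * (1 + i * i)); last by rewrite i2 subrr mulr0.
by field.
Qed.

Lemma pd_expand F q X : cdifferentiable F q ->
  cderive X F q = pd_z F q * cplx X.1 + pd_zbar F q * conjc (cplx X.1)
                  + pd_w F q * cplx X.2 + pd_wbar F q * conjc (cplx X.2).
Proof.
move=> dF.
have eX : X = 1 *: (X.1.1 *: e_x + X.1.2 *: e_y) + (X.2.1 *: e_u + X.2.2 *: e_v).
  case: X => -[x y] [u v].
  rewrite scale1r; congr ((_, _), (_, _)); rewrite /= /GRing.scale /=; ring.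
by rewrite {1}eX cderiveDZ// mul1r !wirtinger_expand// addrA.
Qed.

End Wirtinger.

Lemma continuous_linear_differentiable (R : realType) (V W : normedModType R)
  (f : V -> W) (x : V) : linear f -> continuous f -> differentiable f x.
Proof.
move=> lf cf.
pose mf := GRing.isLinear.Build _ _ _ _ _ lf.
pose F : {linear V -> W} := HB.pack f mf.
exact: (@linear_differentiable _ _ _ F).
Qed.

Lemma derive_continuous_linear (R : realType) (V W : normedModType R)
  (f : V -> W) (x v : V) : linear f -> continuous f -> 'D_v f x = f v.
Proof.
move=> lf cf; rewrite deriveE; last exact: continuous_linear_differentiable.
pose mf := GRing.isLinear.Build _ _ _ _ _ lf.
pose F : {linear V -> W} := HB.pack f mf.
by rewrite (@diff_lin _ _ _ F).
Qed.

(** * The exterior derivative in the adapted coframe *)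

Definition det3 (C : comPzRingType) (T : Type) (a b c : T -> C) (X Y Z : T) : C :=
  a X * (b Y * c Z - b Z * c Y) - a Y * (b X * c Z - b Z * c X)
  + a Z * (b X * c Y - b Y * c X).

Section ExteriorDerivative.
Context {R : realType}.
Local Notation TM := ((R * R) * (R * R))%type.
Implicit Types (q X Y Z : TM).

Section Form.
Variables (L G F A H : TM -> R[i]).

(** The form eta = dw + w G dz for an arbitrary connection coefficient [G]. *)
Definition coframe y X : R[i] := cplx X.2 + cplx y.2 * G y * cplx X.1.

(** The form of the ciconia metric with arbitrary coefficients, so that its
    differential depends only on first-order data at a point. *)
Definition hermitian_form y X Y : R[i] :=
  imag_unit * L y / 2%:R *
  (F y * (cplx X.1 * conjc (cplx Y.1) - conjc (cplx X.1) * cplx Y.1)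
   + A y * (cplx X.1 * conjc (coframe y Y) - conjc (coframe y X) * cplx Y.1)
   + conjc (A y) * (coframe y X * conjc (cplx Y.1) - conjc (cplx X.1) * coframe y Y)
   + H y * (coframe y X * conjc (coframe y Y) - conjc (coframe y X) * coframe y Y)).

End Form.


Lemma is_cderive_coord2 X q : is_cderive X (fun y : TM => cplx y.2) q (cplx X.2).
Proof.
have l1 : linear (fun y : TM => y.2.1) by [].
have c1 : continuous (fun y : TM => y.2.1).
  by move=> y; apply: cvg_comp; [exact: cvg_snd|exact: cvg_fst].
have l2 : linear (fun y : TM => y.2.2) by [].
have c2 : continuous (fun y : TM => y.2.2).
  by move=> y; apply: cvg_comp; [exact: cvg_snd|exact: cvg_snd].
split; first by split; exact: continuous_linear_differentiable.
by rewrite /cderive !derive_continuous_linear.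
Qed.

Lemma is_cderive_coframe (G : TM -> R[i]) X Y q dG : is_cderive X G q dG ->
  is_cderive X (fun y => coframe G y Y) q
    ((cplx X.2 * G q + cplx q.2 * dG) * cplx Y.1).
Proof.
move=> hG; have hw := is_cderive_coord2 X q.
apply: is_cderive_eq.
  apply: is_cderiveD; first exact: is_cderive_cst.
  by apply: is_cderiveM; [exact: is_cderiveM hw hG|exact: is_cderive_cst].
by rewrite add0r mulr0 addr0.
Qed.

Lemma is_cderive_hermitian_form (L G F A H : TM -> R[i]) X Y Z q dL dG dF dA dH :
  is_cderive X L q dL -> is_cderive X G q dG -> is_cderive X F q dF ->
  is_cderive X A q dA -> is_cderive X H q dH ->
  let y1 := cplx Y.1 in let z1 := cplx Z.1 in
  let e := coframe G q in
  let de V := (cplx X.2 * G q + cplx q.2 * dG) * cplx V.1 in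
  is_cderive X (fun y => hermitian_form L G F A H y Y Z) q
  (imag_unit / 2%:R * (
    (dL * F q + L q * dF) * (y1 * conjc z1 - conjc y1 * z1)
    + (dL * A q + L q * dA) * (y1 * conjc (e Z) - conjc (e Y) * z1)
    + L q * A q * (y1 * conjc (de Z) - conjc (de Y) * z1)
    + (dL * conjc (A q) + L q * conjc dA) * (e Y * conjc z1 - conjc y1 * e Z)
    + L q * conjc (A q) * (de Y * conjc z1 - conjc y1 * de Z)
    + (dL * H q + L q * dH) * (e Y * conjc (e Z) - conjc (e Y) * e Z)
    + L q * H q * (de Y * conjc (e Z) + e Y * conjc (de Z)
                   - conjc (de Y) * e Z - conjc (e Y) * de Z))).
Proof.
move=> hL hG hF hA hH y1 z1 e de.
have hY := is_cderive_coframe Y hG; have hZ := is_cderive_coframe Z hG.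
have hc := is_cderive_cst X q.
apply: is_cderive_eq.
  apply: is_cderiveM.
    apply: is_cderiveM; last exact: hc.
    apply: is_cderiveM; [exact: hc|exact: hL].
  apply: is_cderiveD; first apply: is_cderiveD; first apply: is_cderiveD.
  - by apply: is_cderiveM; [exact: hF|exact: hc].
  - apply: is_cderiveM; first exact: hA.
    apply: is_cderiveB; apply: is_cderiveM; try exact: hc.
      exact: is_cderive_conj hZ.
    exact: is_cderive_conj hY.
  - apply: is_cderiveM; first exact: is_cderive_conj hA.
    by apply: is_cderiveB; apply: is_cderiveM; try exact: hc; [exact: hY|exact: hZ].
  - apply: is_cderiveM; first exact: hH.
    apply: is_cderiveB; apply: is_cderiveM.
    + exact: hY.
    + exact: is_cderive_conj hZ.
    + exact: is_cderive_conj hY.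
    + exact: hZ.
rewrite /= -/(de Y) -/(de Z) -/(e Y) -/(e Z) -/y1 -/z1.
move: (conjc (de Y)) (conjc (de Z)) (conjc (e Y)) (conjc (e Z)) => *.
move: (de Y) (de Z) (e Y) (e Z) (conjc y1) (conjc z1) => *.
by field.
Qed.

(** The hypotheses list the differentials of the coefficients in the frame dual
    to (dz, dzbar, eta, etabar); those on [L] and [G] are the structure
    equations, where [Gzbar] stands for - lambda K / 2 and is real. What the
    derivatives of lambda contribute cancels against the term Gam eta ^ dz of
    d eta, and [Gz] drops out by antisymmetry. *)
Lemma ext_deriv2_hermitian_form (L G F A H : TM -> R[i]) q
    (Gz Gzbar F1 F2 A1 A1bar A2 A2bar H1 H2 : R[i]) :
  let z (V : TM) := cplx V.1 in let zb V := conjc (z V) in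
  let e V := coframe G q V in let eb V := conjc (e V) in
  (forall X, is_cderive X L q (L q * (G q * z X + conjc (G q) * zb X))) ->
  (forall X, is_cderive X G q (Gz * z X + Gzbar * zb X)) ->
  (forall X, is_cderive X F q
     (F1 * z X + conjc F1 * zb X + F2 * e X + conjc F2 * eb X)) ->
  (forall X, is_cderive X A q
     (A1 * z X + A1bar * zb X + A2 * e X + A2bar * eb X)) ->
  (forall X, is_cderive X H q
     (H1 * z X + conjc H1 * zb X + H2 * e X + conjc H2 * eb X)) ->
  conjc Gzbar = Gzbar ->
  let EA := H1 - A2 in let EA' := conjc H1 - conjc A2 in
  let EB := F2 - conjc A1bar - conjc (cplx q.2) * Gzbar * H q in
  let EB' := conjc F2 - A1bar - cplx q.2 * Gzbar * H q in
  forall X Y Z,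
  ext_deriv2 (hermitian_form L G F A H) q X Y Z =
  imag_unit / 2%:R * L q * (EB * det3 z zb e X Y Z + EB' * det3 z zb eb X Y Z
    + EA * det3 z e eb X Y Z + EA' * det3 zb e eb X Y Z).
Proof.
move=> z zb e eb hL hG hF hA hH GR EA EA' EB EB' X Y Z.
have D X' Y' Z' := (is_cderive_hermitian_form Y' Z' (hL X') (hG X') (hF X') (hA X') (hH X')).2.
rewrite /ext_deriv2 !D /det3 /EA /EA' /EB /EB' {D hL hG hF hA hH EA EA' EB EB'}.
have e2 V : cplx V.2 = e V - cplx q.2 * G q * z V by rewrite /e /coframe addrK.
rewrite (e2 X) (e2 Y) (e2 Z) -/(z X) -/(z Y) -/(z Z) -/(e X) -/(e Y) -/(e Z) /eb /zb {e2 eb zb}.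
move: (e X) (e Y) (e Z) (z X) (z Y) (z Z) => xe ye ze xo yo zo {e z X Y Z}.
move: (cplx q.2) (L q) (F q) (A q) (H q) (G q) => w l f a h g {q L F A H G}.
rewrite !(conjcD, conjcN, conjcM, conjcK, GR).
move: (imag_unit / 2%:R) => i.
move: (conjc xe) (conjc ye) (conjc ze) (conjc xo) (conjc yo) (conjc zo) => xeb yeb zeb xb yb zb.
move: (conjc w) (conjc g) (conjc a) => wb gb ab.
move: (conjc A1) (conjc A1bar) (conjc A2) (conjc A2bar) => A1c A1bc A2c A2bc.
move: (conjc H1) (conjc H2) (conjc F1) (conjc F2) (conjc Gz) => H1c H2c F1c F2c Gzc.
clear.
ring.
Qed.

End ExteriorDerivative.

Section Nondegeneracy.
Context {R : realType}.
Local Notation TM := ((R * R) * (R * R))%type.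

(** Taking b = conj E gives 2 |E|^2 = 0. *)
Lemma conj_pairing_eq0 (E : R[i]) :
  (forall b, E * b + conjc E * conjc b = 0) -> E = 0.
Proof.
move=> h; have := h (conjc E); rewrite conjcK [conjc E * E]mulrC => /eqP.
rewrite -mulr2n mulrn_eq0 /= mulf_eq0 conjc_eq0 orbb => /eqP//.
Qed.

Lemma coframe_surj (G : TM -> R[i]) q (a b : R[i]) :
  exists V : TM, cplx V.1 = a /\ coframe G q V = b.
Proof.
have cK (x : R[i]) : cplx (complex.Re x, complex.Im x) = x by case: x.
exists ((complex.Re a, complex.Im a),
  (complex.Re (b - cplx q.2 * G q * a), complex.Im (b - cplx q.2 * G q * a))).
by rewrite /coframe /= !cK subrK.
Qed.

(** The four products of three coframe elements are independent over the complex
    numbers, but only real vectors can be inserted: each test triple isolates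
    one conjugate pair of coefficients. *)
Lemma three_forms_eq0 (G : TM -> R[i]) q (k EA EB : R[i]) :
  let z (V : TM) := cplx V.1 in let zb V := conjc (z V) in
  let e V := coframe G q V in let eb V := conjc (e V) in
  k != 0 ->
  (forall X Y Z, k * (EB * det3 z zb e X Y Z + conjc EB * det3 z zb eb X Y Z
    + EA * det3 z e eb X Y Z + conjc EA * det3 zb e eb X Y Z) = 0) <->
  (EA = 0 /\ EB = 0).
Proof.
move=> z zb e eb k0; split; last first.
  by move=> [-> ->] X Y Z; rewrite !conjc0 !mul0r !addr0 mulr0.
move=> h.
have {}h X Y Z : EB * det3 z zb e X Y Z + conjc EB * det3 z zb eb X Y Z
    + EA * det3 z e eb X Y Z + conjc EA * det3 zb e eb X Y Z = 0.
  by have /eqP := h X Y Z; rewrite mulf_eq0 (negPf k0) => /eqP.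
have i0 : - (2%:R * imag_unit) != 0 :> R[i].
  rewrite oppr_eq0 mulf_neq0 ?two_neq0//; apply/eqP => i0.
  by have := @imag_unit2 R; rewrite i0 mul0r => /esym/eqP; rewrite oppr_eq0 oner_eq0.
have [U1 [zU1 eU1]] := coframe_surj G q 1 0.
have [U2 [zU2 eU2]] := coframe_surj G q imag_unit 0.
have [W1 [zW1 eW1]] := coframe_surj G q 0 1.
have [W2 [zW2 eW2]] := coframe_surj G q 0 imag_unit.
(* [U1], [U2] span the horizontal plane, [W1], [W2] the vertical one; the third
   vector lies in the other plane. *)
split; apply: conj_pairing_eq0 => b; apply: (mulfI i0); rewrite mulr0.
- have [B [zB eB]] := coframe_surj G q b 0.
  have := h B W1 W2.
  rewrite /det3 /zb /eb /z /e zB zW1 zW2 eB eW1 eW2.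
  rewrite !conjc0 conjc1 conj_imag_unit => <-; ring.
- have [B [zB eB]] := coframe_surj G q 0 b.
  have := h U1 U2 B.
  rewrite /det3 /zb /eb /z /e zB zU1 zU2 eB eU1 eU2.
  rewrite !conjc0 conjc1 conj_imag_unit => <-; ring.
Qed.

End Nondegeneracy.

(** * Smooth functions on the half line *)

Section HalfLine.
Context {R : realType}.
Implicit Types (phi psi : R -> R) (t : R).

(** Away from 0 the restriction to the half line is invisible to limits. *)
Lemma half_derive_interior phi t : 0 < t ->
  cvg (half_quotient phi t @ half_nbhs t) -> is_derive t 1 phi (half_derive phi t).
Proof.
move=> t0 cq.
have sh : (fun h : R => h + t) @ 0^' --> half_nbhs t.
  move=> P /nbhs_ballP[e /= e0 hP].
  apply/nbhs_ballP; exists (Num.min e t) => /=; first by rewrite lt_min e0.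
  move=> h; rewrite /ball /= sub0r normrN lt_min => /andP[he ht] h0.
  apply: hP; rewrite /ball /=.
  - by rewrite opprD addrCA subrr addr0 normrN.
  - by rewrite -subr_eq0 addrK.
  - by move: ht; rewrite ltr_norml -lerBlDr sub0r => /andP[/ltW].
have cl : (fun h => h^-1 *: (phi (h *: 1 + t) - phi t)) @ 0^' --> half_derive phi t.
  have -> : (fun h => h^-1 *: (phi (h *: 1 + t) - phi t)) =
    half_quotient phi t \o (fun h : R => h + t).
    by apply/funext => h; rewrite /half_quotient /= addrK [h *: 1]mulr1.
  exact: cvg_comp sh cq.
apply: DeriveDef; first by apply/cvg_ex; exists (half_derive phi t).
exact: cvg_lim cl.
Qed.

Lemma half_nbhs0 : half_nbhs (0 : R) = 0^'+.
Proof.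
rewrite eqEsubset; split=> P hP;
  apply: (@filterS _ (nbhs (0 : R)) _ _ _ _ hP) => s /= hs.
- by move=> s0; apply: hs; [rewrite gt_eqF|exact: ltW].
- by move=> s0 sge0; apply: hs; rewrite lt_neqAle eq_sym s0.
Qed.

(** A difference quotient with a limit forces continuity: multiply it by s. *)
Lemma half_cvg0 phi : cvg (half_quotient phi 0 @ half_nbhs 0) ->
  phi @ 0^'+ --> phi 0.
Proof.
rewrite half_nbhs0 => cq.
have id0 : (fun s : R => s) @ 0^'+ --> (0 : R).
  by apply: cvg_at_right_filter; exact: cvg_id.
have cg : (fun s => s * half_quotient phi 0 s + phi 0) @ 0^'+ --> phi 0.
  rewrite -[X in _ --> X]add0r; apply: cvgD; last exact: cvg_cst.
  have c := cvgM id0 cq; rewrite mul0r in c. exact: c.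
apply: cvg_trans cg; apply: near_eq_cvg.
near=> s; have s0 : 0 < s by near: s; exact: nbhs_right_gt.
by rewrite /half_quotient /= subr0 mulrA divff ?gt_eqF// mul1r subrK.
Unshelve. all: by end_near. Qed.

Lemma half_smooth_cvg0 phi : half_smooth phi -> phi @ 0^'+ --> phi 0.
Proof. by move=> sphi; apply/half_cvg0/(sphi 0%N). Qed.

Lemma half_derive_cvg0 phi : half_smooth phi ->
  half_derive phi @ 0^'+ --> half_derive phi 0.
Proof. by move=> sphi; apply/half_cvg0/(sphi 1%N). Qed.

Lemma half_smooth_is_derive phi t : half_smooth phi -> 0 < t ->
  is_derive t 1 phi (half_derive phi t).
Proof. by move=> sphi t0; apply: half_derive_interior => //; apply: (sphi 0%N); exact: ltW. Qed.

Lemma eq0_cvg0 psi : psi @ 0^'+ --> psi 0 -> (forall t, 0 < t -> psi t = 0) ->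
  psi 0 = 0.
Proof.
move=> c0 z; apply: (cvg_unique _ c0) => //.
have cst0 : (fun=> 0 : R) @ (0 : R)^'+ --> (0 : R) by exact: cvg_cst.
apply: cvg_trans cst0; apply: near_eq_cvg.
by near=> s; rewrite z//; near: s; exact: nbhs_right_gt.
Unshelve. all: by end_near. Qed.

(** The mean value theorem on [0, t]: phi is continuous at 0 and differentiable
    inside. *)
Lemma half_derive_cst_affine phi k : half_smooth phi ->
  (forall t, 0 < t -> half_derive phi t = k) ->
  forall t, 0 <= t -> phi t = k * t + phi 0.
Proof.
move=> sphi dk t; rewrite le_eqVlt => /predU1P[<-|t0]; first by rewrite mulr0 add0r.
have dphi (s : R) : 0 < s -> is_derive s 1 phi k.
  by move=> s0; rewrite -(dk _ s0); exact: half_smooth_is_derive.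
have cphi (s : R) : 0 < s -> {for s, continuous phi}.
  move=> s0; apply/differentiable_continuous/derivable1_diffP.
  by case: (dphi _ s0).
have cts : {within `[0, t], continuous phi}.
  apply/continuous_within_itvP => //; split.
  - by move=> s; rewrite in_itv /= => /andP[s0 _]; exact: cphi.
  - exact: half_smooth_cvg0.
  - by apply: cvg_at_left_filter; exact: cphi.
have [s _ e] : exists2 s, s \in `]0, t[%R & phi t - phi 0 = k * (t - 0).
  apply: (@MVT _ _ (fun=> k)) => // s; rewrite in_itv /= => /andP[s0 _].
  exact: dphi.
by rewrite -[LHS](subrK (phi 0)) e subr0.
Qed.

Lemma half_derive_affine phi k b t : half_smooth phi ->
  (forall s, 0 <= s -> phi s = k * s + b) -> 0 < t -> half_derive phi t = k.
Proof.
move=> sphi e t0; have dphi := half_smooth_is_derive sphi t0.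
have dk : is_derive t 1 (fun s => k * s + b) k.
  by apply: is_derive_eq; rewrite addr0 [LHS]mulr1.
have [_ <-] := dphi; have [_ <-] := dk.
apply: near_eq_derive; near=> s; apply: e; apply: ltW.
by near: s; exact: lt_nbhsr.
Unshelve. all: by end_near. Qed.

End HalfLine.

Section Chain.
Context {R : realType} {V : normedModType R}.

Lemma derive_comp1 (phi : R -> R) (rho : V -> R) d x v :
  differentiable rho x -> is_derive (rho x) 1 phi d ->
  differentiable (phi \o rho) x /\ 'D_v (phi \o rho) x = d * 'D_v rho x.
Proof.
move=> drho [/derivable1_diffP dphi <-].
have dc := differentiable_comp drho dphi.
split=> //; rewrite !deriveE// diff_comp//= (diff1E dphi) mulrC.
by rewrite derive1E scale1r.
Qed.

Lemma is_cderive_comp (phi : R -> R[i]) (rho : V -> R) x v :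
  half_csmooth phi -> differentiable rho x -> 0 < rho x ->
  is_cderive v (phi \o rho) x (half_cderive phi (rho x) * ('D_v rho x)%:C).
Proof.
move=> [sr si] drho r0.
have [dr er] := derive_comp1 v drho (half_smooth_is_derive sr r0).
have [di ei] := derive_comp1 v drho (half_smooth_is_derive si r0).
split; first by split.
rewrite /cderive; move: er ei; rewrite /comp => -> ->.
by rewrite /half_cderive; apply/eqP; rewrite eq_complex /=; apply/andP; split;
  apply/eqP; ring.
Qed.

End Chain.

(** * Isothermal charts and the connection coefficient *)

Local Notation coord := Defs.coord.
Local Notation lift := Defs.lift.
Local Notation comp := Defs.comp.
Local Notation iterD := Defs.iterD.

Section Pullback.
Context {R : realType}.
Local Notation TM := ((R * R) * (R * R))%type.

Lemma differentiable_fst (q : TM) : differentiable (fun y : TM => y.1) q.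
Proof.
by apply: continuous_linear_differentiable => // y; exact: cvg_fst.
Qed.

Lemma is_cderive_fst (F0 : R * R -> R[i]) (X q : TM) :
  cdifferentiable F0 q.1 ->
  is_cderive X (fun y => F0 y.1) q
    (d_z F0 q.1 * cplx X.1 + d_zbar F0 q.1 * conjc (cplx X.1)).
Proof.
move=> dF; have [dr di] := dF; split.
  split.
    exact: (differentiable_comp (@differentiable_fst q) dr).
  exact: (differentiable_comp (@differentiable_fst q) di).
rewrite -(wirtinger_expand _ _ _ dF).
have -> : X.1.1 *: (1, 0) + X.1.2 *: (0, 1) = X.1 :> R * R.
  case: X => -[x y] w; congr (_, _); rewrite /= /GRing.scale /=; ring.
by [].
Qed.

End Pullback.

Section Surface.
Context {R : realType} (S : riemannian_surface R).
Implicit Types (c : chart R S) (z v : R * R) (u : tangent S).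

Lemma lambda_gt0 c z : isothermal c -> img c z -> 0 < lambda c z.
Proof.
move=> [ac _] iz.
have v0 : (1, 0) != 0 :> R * R by apply/eqP => -[/eqP]; rewrite oner_eq0.
have := metric_gt0 ac iz v0.
by rewrite /metric_form /symm_form /= !mulr0 !mul0r !addr0 !mulr1 mulr0 addr0.
Qed.

Lemma param_dom c z : img c z -> dom c (param c z) /\ coord c (param c z) = z.
Proof. by move=> [p cp <-]; rewrite coordK. Qed.

(** The chart used to define [r2] is arbitrary, so the invariance of the metric
    carries the computation to the isothermal chart. *)
Lemma r2_lift c z v : isothermal c -> img c z ->
  r2 (lift c z v) = lambda c z * (v.1 ^+ 2 + v.2 ^+ 2).
Proof.
move=> [ac cc] iz; rewrite /r2 /=.
case: cid2 => c' ac' /= c'p.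
have [cp cz] := param_dom iz.
have oz : overlap c c' z by exists (param c z).
rewrite /lift_comp asboolT; last by [].
have := metric_invariant v v ac ac' oz; rewrite /transition /= => ->.
have [e f] := cc z iz.
by rewrite /metric_form /symm_form -e f /lambda; ring.
Qed.

Lemma tangent_eq u u' : base u = base u' -> comp u = comp u' -> u = u'.
Proof.
case: u => p k kt ko; case: u' => p' k' kt' ko' /= ep ek.
by subst; congr Tangent; exact: Prop_irrelevance.
Qed.

(** Every tangent vector has coordinates in every chart at its base point, so
    identities on the tangent bundle may be checked in isothermal charts. *)
Lemma lift_surj u c : atlas c -> dom c (base u) ->
  img c (coord c (base u)) /\ lift c (coord c (base u)) (comp u c) = u.
Proof.
move=> ac cu; have iz : img c (coord c (base u)) by exists (base u).
split=> //; apply: tangent_eq; rewrite /= ?coordK//.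
apply/funext => c'; rewrite /lift_comp.
have [h|h] := pselect (chart_at c' (param c (coord c (base u)))).
  rewrite asboolT//; rewrite coordK// in h.
  by rewrite -comp_transition.
rewrite asboolF; last by case.
by rewrite comp_out//; rewrite coordK// in h.
Qed.

Section Connection.
Variables (c : chart R S) (ic : isothermal c).

Lemma lambda_smooth : smooth_on (img c) (lambda c).
Proof. by have [] := metric_smooth (proj1 ic). Qed.

Lemma lambda_cdifferentiable z : img c z ->
  cdifferentiable (fun z' => (lambda c z')%:C) z.
Proof. by move=> iz; apply: (is_cderive_real 0 (lambda_smooth [::] iz)).1. Qed.

Lemma d_z_lambda z : img c z ->
  d_z (fun z' => (lambda c z')%:C) z = (lambda c z)%:C * Gam c z.
Proof.
move=> iz; rewrite /Gam mulrA -rmorphM divff ?mul1r//.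
by rewrite gt_eqF// lambda_gt0.
Qed.

Lemma d_zbar_conj (F : R * R -> R[i]) z : cdifferentiable F z ->
  d_zbar (fun z' => conjc (F z')) z = conjc (d_z F z).
Proof.
move=> dF; rewrite /d_zbar /d_z.
rewrite (is_cderive_conj (is_cderiveP (1 : R, 0 : R) dF)).2.
rewrite (is_cderive_conj (is_cderiveP (0 : R, 1 : R) dF)).2.
by rewrite conjcM conjc_inv conjc_nat conjcD conjcN conjcM conj_imag_unit mulNr opprK.
Qed.

Lemma d_zbar_lambda z : img c z ->
  d_zbar (fun z' => (lambda c z')%:C) z = (lambda c z)%:C * conjc (Gam c z).
Proof.
move=> iz; have := d_zbar_conj (lambda_cdifferentiable iz).
rewrite d_z_lambda// conjcM conjc_real => <-.
by congr (d_zbar _ z); apply/funext => z'; exact/esym/conjc_real.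
Qed.

(** Gam is the conjugate of a zbar-derivative of log lambda, which lets the
    curvature formula be read as a formula for dGam/dzbar. *)
Lemma d_zbar_ln_lambda z : img c z ->
  d_zbar (fun z' => (ln (lambda c z'))%:C) z = conjc (Gam c z).
Proof.
move=> iz; have l0 := lambda_gt0 ic iz.
have dl := lambda_smooth [::] iz.
have e v : cderive v (fun z' => (ln (lambda c z'))%:C) z =
    ((lambda c z)^-1)%:C * cderive v (fun z' => (lambda c z')%:C) z.
  have [d1 d2] := derive_comp1 v dl (is_derive1_ln l0).
  rewrite (is_cderive_real v d1).2 d2 (is_cderive_real v dl).2.
  exact: rmorphM.
have := d_zbar_lambda iz; rewrite /d_zbar !e => h.
have -> : conjc (Gam c z) = ((lambda c z)^-1)%:C * ((lambda c z)%:C * conjc (Gam c z)).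
  by rewrite mulrA -rmorphM mulVf ?gt_eqF// mul1r.
by rewrite -h; ring.
Qed.

Lemma Gam_cdifferentiable z : img c z -> cdifferentiable (Gam c) z.
Proof.
move=> iz; have l0 := lambda_gt0 ic iz.
have ds vs : differentiable (iterD vs (lambda c)) z := lambda_smooth vs iz.
have dv : differentiable (fun z' => (lambda c z')^-1) z.
  by apply: (@differentiableV _ _ (lambda c)); [exact: ds [::]|rewrite gt_eqF].
have dd v : is_cderive 0 (fun z' => cderive v (fun z'' => (lambda c z'')%:C) z') z 
   (cderive 0 (fun z' => cderive v (fun z'' => (lambda c z'')%:C) z') z).
  apply: is_cderiveP; split; first exact: (ds [:: v]).
  rewrite /cderive /=.
  have -> : 'D_v (fun=> 0 : R) = (fun=> 0) :> (R * R -> R).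
    by apply/funext => y; rewrite derive_cst.
  exact: differentiable_cst.
have hc := is_cderive_cst (0 : R * R) z.
apply: (proj1 (_ : is_cderive 0 (Gam c) z _)).
apply: is_cderiveM; first exact: is_cderive_real dv.
apply: is_cderiveM; last exact: hc.
by apply: is_cderiveB; [exact: dd|apply: is_cderiveM; [exact: hc|exact: dd]].
Qed.

(** Conjugation turns d_zbar Gam into d_z (d_zbar (log lambda)), which the
    curvature formula identifies with the real number - lambda K / 2. Reality is
    part of that formula, because K is a real function. *)
Lemma d_zbar_Gam (K : S -> R) p : gauss_curvature K -> dom c p ->
  d_zbar (Gam c) (coord c p) = - (lambda c (coord c p) * K p / 2%:R)%:C.
Proof.
move=> hK cp; have iz : img c (coord c p) by exists p.
have l0 := lambda_gt0 ic iz.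
set z := coord c p in iz l0 *.
have nz : \forall z' \near z, img c z'.
  by have := open_nbhs_nbhs (conj (@img_open _ _ c) iz); apply.
have hk := hK c p ic cp; rewrite -/z in hk.
have e1 : d_z (d_zbar (fun z' => (ln (lambda c z'))%:C)) z =
   - (lambda c z * K p / 2%:R)%:C.
  have h : (lambda c z * K p / 2%:R)%:C = (lambda c z / 2%:R)%:C * (K p)%:C.
    by rewrite -rmorphM; congr (_%:C); ring.
  rewrite h hk mulrA mulrN -rmorphM.
  have -> : lambda c z / 2%:R * (2%:R / lambda c z) = 1.
    by field; rewrite gt_eqF.
  by rewrite mulN1r opprK.
have e2 : d_z (d_zbar (fun z' => (ln (lambda c z'))%:C)) z =
   d_z (fun z' => conjc (Gam c z')) z.
  rewrite /d_z; congr ((_ - _ * _) / _); apply: near_cderive;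
    by near=> z'; apply: d_zbar_ln_lambda; near: z'.
have dG := (is_cderive_conj (is_cderiveP (0 : R * R) (Gam_cdifferentiable iz))).1.
have := d_zbar_conj dG; rewrite -e2 e1.
have -> : (fun z' => conjc (conjc (Gam c z'))) = Gam c.
  by apply/funext => z'; rewrite conjcK.
by move=> ->; rewrite conjcN conjc_real.
Unshelve. all: by end_near. Qed.

End Connection.
End Surface.

(** * Closedness as two equations *)

Section RealFunctions.
Context {R : realType}.
Local Notation TM := ((R * R) * (R * R))%type.

Lemma conj_wirtinger (x y : R) :
  (x%:C + imag_unit * y%:C) / 2%:R = conjc ((x%:C - imag_unit * y%:C) / 2%:R).
Proof.
rewrite conjcM conjc_inv conjc_nat conjcD conjcN conjcM conj_imag_unit.
by rewrite !conjc_real mulNr opprK.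
Qed.

Lemma pd_zbar_real (F : TM -> R) q :
  pd_zbar (fun y => (F y)%:C) q = conjc (pd_z (fun y => (F y)%:C) q).
Proof.
have e v : cderive v (fun y : TM => (F y)%:C) q = ('D_v F q)%:C.
  by rewrite /cderive /= derive_cst.
by rewrite /pd_zbar /pd_z !e conj_wirtinger.
Qed.

Lemma pd_wbar_real (F : TM -> R) q :
  pd_wbar (fun y => (F y)%:C) q = conjc (pd_w (fun y => (F y)%:C) q).
Proof.
have e v : cderive v (fun y : TM => (F y)%:C) q = ('D_v F q)%:C.
  by rewrite /cderive /= derive_cst.
by rewrite /pd_wbar /pd_w !e conj_wirtinger.
Qed.

End RealFunctions.

Section Criterion.
Context {R : realType} (S : riemannian_surface R).
Local Notation TM := ((R * R) * (R * R))%type.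
Implicit Types (c : chart R S) (q X : TM) (F : TM -> R[i]).

Definition pull c (F : tangent S -> R[i]) (q : TM) : R[i] := F (lift c q.1 q.2).

(** The components of dF along dz and dzbar in the coframe completed by eta and
    etabar. *)
Definition hor c F q : R[i] :=
  pd_z F q - cplx q.2 * Gam c q.1 * pd_w F q.

Definition horbar c F q : R[i] :=
  pd_zbar F q - conjc (cplx q.2 * Gam c q.1) * pd_wbar F q.

Lemma frame_expand c F q X : cdifferentiable F q ->
  let e := coframe (fun y => Gam c y.1) q X in
  is_cderive X F q (hor c F q * cplx X.1 + horbar c F q * conjc (cplx X.1)
    + pd_w F q * e + pd_wbar F q * conjc e).
Proof.
move=> dF e; split=> //; rewrite (pd_expand X dF) /hor /horbar /e /coframe.
rewrite conjcD conjcM; ring.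
Qed.

Lemma horbar_real c (F : TM -> R) q :
  horbar c (fun y => (F y)%:C) q = conjc (hor c (fun y => (F y)%:C) q).
Proof.
rewrite /horbar /hor pd_zbar_real pd_wbar_real.
move: (pd_z _ _) (pd_w _ _) (cplx q.2 * _) => x y w.
by rewrite conjcD conjcN [conjc (w * y)]conjcM.
Qed.

Lemma conj_vertical_defect (F2 Ab w g r : R[i]) : conjc g = g -> conjc r = r ->
  conjc (F2 - conjc Ab - conjc w * g * r) = conjc F2 - Ab - w * g * r.
Proof. by move=> hg hr; rewrite !(conjcD, conjcN, conjcM, conjcK) hg hr. Qed.

Lemma smooth_TM_cdifferentiable c (F : tangent S -> R[i]) q :
  smooth_TM F -> atlas c -> img c q.1 -> cdifferentiable (pull c F) q.
Proof.
move=> sF ac iq; have [sr si] := sF c ac.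
by have := sr [::] q (conj iq I); have := si [::] q (conj iq I).
Qed.

(** On a vertical vector the metric reduces to lambda h |eta|^2. *)
Lemma posdef_h_gt0 f a h (u : tangent S) : ciconia_posdef f a h -> 0 < h u.
Proof.
move=> pos; have [c [ac cu cc]] := isothermal_cover (base u).
have ic : isothermal c by [].
have [iz eu] := lift_surj ac cu.
have l0 := lambda_gt0 ic iz.
have v0 : ((0, 0), (1, 0)) != 0 :> TM.
  by apply/eqP => -[/eqP]; rewrite oner_eq0.
have := pos c (coord c (base u), comp u c) _ ic iz v0.
set V : TM := ((0, 0), (1, 0)).
have z0 : form_dz V = 0 by [].
have e1 : form_eta c (coord c (base u), comp u c) V = 1.
  by rewrite /form_eta z0 mulr0 addr0.
rewrite /ciconia [lift _ _ _]eu /sym_prod /form_conj z0 e1.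
rewrite !(mulr0, mul0r, conjc0, addr0, add0r, conjc1, mulr1, mul1r).
have -> : (lambda c (coord c (base u)))%:C / 2%:R * ((h u)%:C * (1 + 1)) =
  (lambda c (coord c (base u)) * h u)%:C by rewrite rmorphM; field.
by rewrite ltcR pmulr_rgt0.
Qed.

Variables (K : S -> R) (f h : tangent S -> R) (a : tangent S -> R[i]).
Hypotheses (hK : gauss_curvature K)
    (smooth_f : smooth_TM (complexify f))
    (smooth_a : smooth_TM a)
    (smooth_h : smooth_TM (complexify h)).

(** The coefficients of the metric satisfy the structure equations, so closedness
    at a point reduces to the independence of the coframe products. *)
Lemma ext_ciconia_form_eq0 c q : isothermal c -> img c q.1 ->
  (forall X Y Z, ext_deriv2 (ciconia_form f a h c) q X Y Z = 0) <->
  hor c (pull c (complexify h)) q = pd_w (pull c a) q /\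
  pd_w (pull c (complexify f)) q = conjc (horbar c (pull c a) q)
    - conjc (cplx q.2) * (lambda c q.1 * K (param c q.1) / 2%:R * h (lift c q.1 q.2))%:C.
Proof.
move=> ic iq; have [ac cc] := ic.
have l0 := lambda_gt0 ic iq.
have [cp ecp] := param_dom iq.
pose L (y : TM) := (lambda c y.1)%:C; pose G (y : TM) := Gam c y.1.
pose Gzbar := - (lambda c q.1 * K (param c q.1) / 2%:R)%:C.
have hL X : is_cderive X L q
    (L q * (G q * cplx X.1 + conjc (G q) * conjc (cplx X.1))).
  apply: is_cderive_eq; first exact: is_cderive_fst (lambda_cdifferentiable ic iq).
  by rewrite d_z_lambda// d_zbar_lambda// mulrDr !mulrA.
have hG X : is_cderive X G q (d_z (Gam c) q.1 * cplx X.1 + Gzbar * conjc (cplx X.1)).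
  apply: is_cderive_eq; first exact: is_cderive_fst (Gam_cdifferentiable ic iq).
  by have := d_zbar_Gam ic hK cp; rewrite ecp => ->.
have dF := smooth_TM_cdifferentiable smooth_f ac iq.
have dA := smooth_TM_cdifferentiable smooth_a ac iq.
have dH := smooth_TM_cdifferentiable smooth_h ac iq.
have hF X := frame_expand c X dF.
have hA X := frame_expand c X dA.
have hH X := frame_expand c X dH.
rewrite /= in hF hA hH.
have GR : conjc Gzbar = Gzbar.
  by rewrite /Gzbar conjcN; congr (- _); exact: conjc_real.
have hF' X : is_cderive X (pull c (complexify f)) q
     (hor c (pull c (complexify f)) q * cplx X.1
      + conjc (hor c (pull c (complexify f)) q) * conjc (cplx X.1)
      + pd_w (pull c (complexify f)) q * coframe G q X
      + conjc (pd_w (pull c (complexify f)) q) * conjc (coframe G q X)).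
  apply: is_cderive_eq; first exact: hF.
  by rewrite [horbar _ _ _]horbar_real [pd_wbar _ _]pd_wbar_real.
have hH' X : is_cderive X (pull c (complexify h)) q
     (hor c (pull c (complexify h)) q * cplx X.1
      + conjc (hor c (pull c (complexify h)) q) * conjc (cplx X.1)
      + pd_w (pull c (complexify h)) q * coframe G q X
      + conjc (pd_w (pull c (complexify h)) q) * conjc (coframe G q X)).
  apply: is_cderive_eq; first exact: hH.
  by rewrite [horbar _ _ _]horbar_real [pd_wbar _ _]pd_wbar_real.
have E := ext_deriv2_hermitian_form hL hG hF' hA hH' GR.
have k0 : imag_unit / 2%:R * L q != 0.
  rewrite !mulf_neq0 ?invr_eq0 ?two_neq0//.
    by apply/eqP => i0; have := @imag_unit2 R; rewrite i0 mul0r => /esym/eqP;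
      rewrite oppr_eq0 oner_eq0.
  by rewrite /L eq_complex /= eqxx andbT gt_eqF.
set EA := hor c (pull c (complexify h)) q - pd_w (pull c a) q.
set EB := pd_w (pull c (complexify f)) q - conjc (horbar c (pull c a) q)
    - conjc (cplx q.2) * Gzbar * pull c (complexify h) q.
have T := three_forms_eq0 G q EA EB k0.
have -> : (forall X Y Z, ext_deriv2 (ciconia_form f a h c) q X Y Z = 0) <->
   EA = 0 /\ EB = 0.
  apply: iff_trans T.
  have eB : conjc EB = conjc (pd_w (pull c (complexify f)) q) - horbar c (pull c a) q
    - cplx q.2 * Gzbar * pull c (complexify h) q.
    by apply: conj_vertical_defect => //; exact: conjc_real.
  have eA : conjc EA = conjc (hor c (pull c (complexify h)) q) - conjc (pd_w (pull c a) q).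
    by rewrite -conjcN -conjcD.
  rewrite eA eB.
  split=> h0 X Y Z; first exact: etrans (esym (E X Y Z)) (h0 X Y Z).
  exact: etrans (E X Y Z) (h0 X Y Z).
have -> : EB = pd_w (pull c (complexify f)) q - (conjc (horbar c (pull c a) q)
    - conjc (cplx q.2) * (lambda c q.1 * K (param c q.1) / 2%:R * h (lift c q.1 q.2))%:C).
  rewrite /EB /Gzbar [(_ * h _)%:C]rmorphM /= /pull /complexify; ring.
rewrite /EA; split=> -[/eqP e1 /eqP e2].
  by split; apply/eqP; rewrite -subr_eq0.
by rewrite (eqP e1) (eqP e2) !subrr.
Qed.

End Criterion.

(** * Frame components of pullbacks and of functions of the squared norm *)

Section ZeroSection.
Context {R : realType}.
Local Notation TM := ((R * R) * (R * R))%type.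
Implicit Types (f : TM -> R) (x z v : R * R).

Lemma derive_zero_section f x z :
  'D_((x, 0) : TM) f (z, 0) = 'D_x (fun z' => f (z', 0)) z.
Proof.
rewrite /derive; apply: (congr1 (fun g : R -> R => lim (g @ 0^'))); apply/funext => s /=.
have -> : s *: ((x, 0) : TM) + (z, 0) = (s *: x + z, 0) :> TM.
  by congr (_, _); exact: etrans (addr0 _) (scaler0 _ _).
by [].
Qed.

(** Reflection of the fibre changes the sign of a vertical derivative at the zero
    section and, for an even function, also preserves it. *)
Lemma derive_even f z v : differentiable f (z, 0) ->
  (forall w, f (z, - w) = f (z, w)) -> 'D_((0, v) : TM) f (z, 0) = 0.
Proof.
move=> df ev.
have e w : 'D_((0, w) : TM) f (z, 0) = 'D_w (fun w' => f (z, w')) 0.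
  rewrite /derive; apply: (congr1 (fun g : R -> R => lim (g @ 0^'))); apply/funext => s /=.
  have -> : s *: ((0, w) : TM) + (z, 0) = (z, s *: w + 0) :> TM.
    by congr (_, _); exact: etrans (congr1 (+%R^~ z) (scaler0 _ s)) (add0r z).
  by [].
have eN : 'D_((0, - v) : TM) f (z, 0) = 'D_((0, v) : TM) f (z, 0).
  rewrite !e /derive; apply: (congr1 (fun g : R -> R => lim (g @ 0^'))); apply/funext => s /=.
  by rewrite !addr0 scalerN ev.
have : 'D_((0, - v) : TM) f (z, 0) = - 'D_((0, v) : TM) f (z, 0).
  rewrite !deriveE// -linearN; congr ('d f _ _).
  by congr (_, _); exact/esym/oppr0.
by rewrite eN => /eqP; rewrite -addr_eq0 -mulr2n mulrn_eq0 => /eqP.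
Qed.

End ZeroSection.

Section FrameComponents.
Context {R : realType} (S : riemannian_surface R).
Local Notation TM := ((R * R) * (R * R))%type.
Implicit Types (c : chart R S) (q X : TM) (F : TM -> R[i]).

(** The coframe is a basis: coefficients of an expansion of dF are read off on
    the real coordinate vectors. *)
Lemma frame_unique c F q (A Abar B Bbar : R[i]) :
  (forall X, let e := coframe (fun y => Gam c y.1) q X in
     cderive X F q = A * cplx X.1 + Abar * conjc (cplx X.1) + B * e + Bbar * conjc e) ->
  [/\ hor c F q = A, horbar c F q = Abar, pd_w F q = B & pd_wbar F q = Bbar].
Proof.
move=> h.
have x1 : cplx (@e_x R).1 = 1 by [].
have x2 : cplx (@e_x R).2 = 0 by [].
have y1 : cplx (@e_y R).1 = imag_unit by [].
have y2 : cplx (@e_y R).2 = 0 by [].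
have u1 : cplx (@e_u R).1 = 0 by [].
have u2 : cplx (@e_u R).2 = 1 by [].
have v1 : cplx (@e_v R).1 = 0 by [].
have v2 : cplx (@e_v R).2 = imag_unit by [].
have i2 := @imag_unit2 R.
set g := cplx q.2 * Gam c q.1 in h *.
have hx : cderive e_x F q = A + Abar + B * g + Bbar * conjc g.
  by rewrite h /coframe -/g x1 x2 conjc1 add0r !mulr1.
have hy : cderive e_y F q = A * imag_unit - Abar * imag_unit
    + B * g * imag_unit - Bbar * conjc g * imag_unit.
  rewrite h /coframe -/g y1 y2 add0r conj_imag_unit.
  rewrite [conjc (g * _)]conjcM conj_imag_unit; ring.
have hu : cderive e_u F q = B + Bbar.
  by rewrite h /coframe u1 u2 conjc0 !(mulr0, addr0, add0r) conjc1 !mulr1.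
have hv : cderive e_v F q = B * imag_unit - Bbar * imag_unit.
  by rewrite h /coframe v1 v2 conjc0 !(mulr0, addr0, add0r) conj_imag_unit mulrN.
(* In each component the extra term is a multiple of 1 + i ^ 2. *)
have ew : pd_w F q = B.
  rewrite /pd_w hu hv; transitivity (B - (B - Bbar) / 2%:R * (1 + imag_unit * imag_unit)).
    by field.
  by rewrite i2 subrr mulr0 subr0.
have ewb : pd_wbar F q = Bbar.
  rewrite /pd_wbar hu hv; transitivity (Bbar + (B - Bbar) / 2%:R * (1 + imag_unit * imag_unit)).
    by field.
  by rewrite i2 subrr mulr0 addr0.
split=> //.
- rewrite /hor ew /pd_z hx hy -/g.
  transitivity (A - (A - Abar + B * g - Bbar * conjc g) / 2%:R * (1 + imag_unit * imag_unit)).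
    by field.
  by rewrite i2 subrr mulr0 subr0.
- rewrite /horbar ewb /pd_zbar hx hy -/g.
  transitivity (Abar + (A - Abar + B * g - Bbar * conjc g) / 2%:R * (1 + imag_unit * imag_unit)).
    by field.
  by rewrite i2 subrr mulr0 addr0.
Qed.

Lemma frame_fst c (F0 : R * R -> R[i]) q :
  [/\ hor c (fun y => F0 y.1) q = d_z F0 q.1,
      horbar c (fun y => F0 y.1) q = d_zbar F0 q.1
    & pd_w (fun y => F0 y.1) q = 0].
Proof.
have eu : cderive e_u (fun y : TM => F0 y.1) q = 0.
  transitivity (cderive (0 : R * R) F0 q.1); first by [].
  by rewrite /cderive !derive0.
have ev : cderive e_v (fun y : TM => F0 y.1) q = 0.
  transitivity (cderive (0 : R * R) F0 q.1); first by [].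
  by rewrite /cderive !derive0.
have ew : pd_w (fun y : TM => F0 y.1) q = 0.
  by rewrite /pd_w eu ev mulr0 subrr mul0r.
have ewb : pd_wbar (fun y : TM => F0 y.1) q = 0.
  by rewrite /pd_wbar eu ev mulr0 addr0 mul0r.
by split=> //; rewrite /hor /horbar ?ew ?ewb mulr0 subr0.
Qed.

(** Off the zero section this is the chain rule for phi at r^2 > 0, with
    d (r^2) = lambda (wbar eta + w etabar). On the zero section r^2 is 0, where
    phi has only a one-sided derivative; there F is constant along the section
    and even along the fibre, so dF vanishes, and so does the right-hand side. *)
Lemma frame_radial c phi (F : tangent S -> R[i]) q :
  isothermal c -> img c q.1 -> smooth_TM F -> radial_by phi F ->
  [/\ hor c (pull c F) q = 0, horbar c (pull c F) q = 0
    & pd_w (pull c F) q = half_cderive phi (r2 (lift c q.1 q.2))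
                          * (lambda c q.1)%:C * conjc (cplx q.2)].
Proof.
move=> ic iq sF [sphi Fphi]; have [ac _] := ic.
have l0 := lambda_gt0 ic iq.
have dF := smooth_TM_cdifferentiable sF ac iq.
pose rho (y : TM) := lambda c y.1 * (y.2.1 ^+ 2 + y.2.2 ^+ 2).
have Frho y : img c y.1 -> pull c F y = phi (rho y).
  by move=> iy; rewrite /pull Fphi r2_lift.
have er : r2 (lift c q.1 q.2) = rho q by rewrite r2_lift.
have ni : \forall y \near q, img c y.1.
  have := open_nbhs_nbhs (conj (@img_open _ _ c) iq).
  exact: (@cvg_fst _ _ (nbhs q.1) (nbhs q.2) _ _).
set w := cplx q.2.
pose L (y : TM) := (lambda c y.1)%:C; pose G (y : TM) := Gam c y.1.
have hL X : is_cderive X L q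
    (L q * (G q * cplx X.1 + conjc (G q) * conjc (cplx X.1))).
  apply: is_cderive_eq; first exact: is_cderive_fst (lambda_cdifferentiable ic iq).
  by rewrite d_z_lambda// d_zbar_lambda// mulrDr !mulrA.
have [q0|q0] := eqVneq q.2 0.
  have c0 : conjc w = 0 by rewrite /w q0 conjc0.
  have eq0 : q = (q.1, 0) by rewrite -q0; case: (q).
  have rho00 z : rho (z, 0) = 0 by rewrite /rho /= expr0n /= addr0 mulr0.
  have dh x : cderive ((x, 0) : TM) (pull c F) q = 0.
    have ni1 : \forall z \near q.1, img c z.
      by have := open_nbhs_nbhs (conj (@img_open _ _ c) iq); apply.
    rewrite eq0 /cderive !derive_zero_section.
    have -> : 'D_x (fun z => complex.Re (pull c F (z, 0))) q.1 = 0.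
      rewrite -(derive_cst (complex.Re (phi 0)) q.1 x); apply: near_eq_derive.
      by near=> z; rewrite Frho ?rho00//; near: z.
    have -> : 'D_x (fun z => complex.Im (pull c F (z, 0))) q.1 = 0.
      rewrite -(derive_cst (complex.Im (phi 0)) q.1 x); apply: near_eq_derive.
      by near=> z; rewrite Frho ?rho00//; near: z.
    by [].
  have dv x : cderive ((0, x) : TM) (pull c F) q = 0.
    have ev v : pull c F (q.1, - v) = pull c F (q.1, v).
      by rewrite !Frho// /rho /= !sqrrN.
    move: dF; rewrite eq0 /cderive => -[dr di].
    by rewrite !derive_even// => v; rewrite ev.
  have ex : cderive e_x (pull c F) q = 0 := dh (1, 0).
  have ey : cderive e_y (pull c F) q = 0 := dh (0, 1).
  have eu : cderive e_u (pull c F) q = 0 := dv (1, 0).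
  have ev : cderive e_v (pull c F) q = 0 := dv (0, 1).
  rewrite /hor /horbar /pd_z /pd_zbar /pd_w /pd_wbar ex ey eu ev c0.
  by rewrite !(mulr0, subr0, addr0, mul0r).
have rho0 : 0 < rho q.
  by apply: mulr_gt0 => //; exact: sqr_norm_gt0.
have rhoE : (fun y => (rho y)%:C) = (fun y => L y * (cplx y.2 * conjc (cplx y.2))).
  apply/funext => y; rewrite /L /rho; apply: etrans (rmorphM _ _ _) _.
  congr (_ * _); case: y.2 => u v; apply: complex_ext;
    rewrite !(Re_mulc, Im_mulc) /=; ring.
have hrho X : is_cderive X (fun y => (rho y)%:C) q
    (L q * conjc w * coframe G q X + L q * w * conjc (coframe G q X)).
  rewrite rhoE; apply: is_cderive_eq.
    apply: is_cderiveM; first exact: hL.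
    apply: is_cderiveM; first exact: is_cderive_coord2.
    exact: is_cderive_conj (is_cderive_coord2 X q).
  rewrite /coframe -/w; move: (cplx X.1) (cplx X.2) (L q) (G q) => x1 x2 l g.
  rewrite conjcD !conjcM; ring.
have drho : differentiable rho q by have [[]] := hrho 0.
have hF X : cderive X (pull c F) q = half_cderive phi (rho q) * (
    L q * conjc w * coframe G q X + L q * w * conjc (coframe G q X)).
  rewrite -(hrho X).2 (is_cderive_real X drho).2 -(is_cderive_comp X sphi drho rho0).2.
  by apply: near_cderive; near=> y; apply: Frho; near: y.
have [] := @frame_unique c (pull c F) q 0 0 (half_cderive phi (rho q) * L q * conjc w)
  (half_cderive phi (rho q) * L q * w).
  move=> X e; rewrite hF /e; ring.
by rewrite er => *; split.
Unshelve. all: by end_near. Qed.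

End FrameComponents.

(** * Functions with vanishing derivative, and restriction to the zero section *)

Section Constancy.
Context {R : realType}.

Lemma ball_constant (V : normedModType R) (f : V -> R) (x : V) (r : R) :
  (forall y, ball x r y -> differentiable f y /\ forall v, 'D_v f y = 0) ->
  forall y, ball x r y -> f y = f x.
Proof.
move=> df y xy.
pose path (s : R) : V := s *: (y - x) + x.
have dpath s : differentiable path s.
  by apply: differentiableD => //; exact: differentiableZl.
have path_ball (s : R) : 0 <= s <= 1 -> ball x r (path s).
  move=> /andP[s0 s1]; rewrite -ball_normE /= /path opprD addrCA subrr addr0 normrN.
  rewrite normrZ ger0_norm//.
  move: xy; rewrite -ball_normE /= distrC; apply: le_lt_trans.
  by rewrite ler_piMl.
have dg (s : R) : 0 <= s <= 1 -> is_derive s 1 (f \o path) 0.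
  move=> s01; have [dfs d0] := df _ (path_ball _ s01).
  have dc := differentiable_comp (dpath s) dfs.
  apply: DeriveDef; first exact/derivable1_diffP.
  by rewrite deriveE// diff_comp//= -deriveE.
have [s _ e] : exists2 s : R, s \in `]0, 1[%R & (f \o path) 1 - (f \o path) 0 = 0 * (1 - 0 : R).
  apply: (@MVT _ _ (fun=> 0)) => //.
    by move=> s; rewrite in_itv /= => /andP[s0 s1]; apply: dg; rewrite !ltW.
  apply: derivable_within_continuous => s; rewrite in_itv /= => s01.
  by have [] := dg _ s01.
by move: e; rewrite mul0r /= /path scale1r subrK scale0r add0r => /eqP; rewrite subr_eq0 => /eqP.
Qed.

(** The function is locally constant in isothermal charts, so its level sets are
    both open and closed in the connected surface. *)
Lemma surface_constant (S : riemannian_surface R) (F : S -> R) :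
  (forall c z, isothermal c -> img c z ->
    differentiable (F \o param c) z /\ forall v, 'D_v (F \o param c) z = 0) ->
  forall p p', F p = F p'.
Proof.
move=> dF.
have loc p : \forall p' \near p, F p' = F p.
  have [c [ac cp cc]] := isothermal_cover p.
  have ip : img c (coord c p) by exists p.
  have ni : nbhs (coord c p) (img c).
    by have := open_nbhs_nbhs (conj (@img_open _ _ c) ip); apply.
  have [r /= r0 br] : exists2 r : R, 0 < r & ball (coord c p) r `<=` img c.
    by move: ni => /nbhs_ballP.
  have cst z : ball (coord c p) r z -> F (param c z) = F p.
    move=> bz; rewrite -[in RHS](coordK cp).
    apply: (@ball_constant _ (F \o param c) _ r _ z bz) => y /br iy.
    by apply: dF.
  have /subspace_continuousP/(_ _ cp) cc' := @Defs.coord_continuous _ _ c.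
  have nd : \forall p' \near p, dom c p'.
    exact: (open_nbhs_nbhs (conj (dom_open c) cp)).
  have nb : \forall p' \near p, dom c p' -> ball (coord c p) r (coord c p').
    exact: (cc' _ (nbhsx_ballx (coord c p) r r0)).
  near=> p'.
  have dp' : dom c p' by near: p'.
  rewrite -{1}(coordK dp'); apply: cst.
  by move: dp'; near: p'.
move=> p p'.
have openP (P : R -> Prop) : open [set q | P (F q)].
  rewrite openE => q /= Pq; rewrite /interior; near=> q'.
  by rewrite /= (_ : F q' = F q)//; near: q'; exact: loc.
have : [set q | F q = F p'] = [set: S].
  apply: (@surface_connected _ S).
  - by exists p'.
  - by exists [set q | F q = F p']; [exact: openP (fun y => y = F p')|rewrite setTI].
  - exists [set q | F q = F p']; last by rewrite setTI.
    by rewrite -[X in closed X]setCK; apply: open_closedC; exact: openP (fun y => ~ (y = F p')).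
by move=> /seteqP[_ /(_ p I)].
Unshelve. all: by end_near. Qed.

End Constancy.

Section ZeroSectionSmooth.
Context {R : realType}.
Local Notation TM := ((R * R) * (R * R))%type.

(** Directions tangent to the zero section commute with restriction to it. *)
Lemma iterD_zero_section (f : TM -> R) vs z :
  iterD vs (fun z' => f (z', 0)) z = iterD [seq (v, 0) : TM | v <- vs] f (z, 0).
Proof.
elim: vs z => //= v vs IH z; rewrite derive_zero_section.
by congr ('D_v _ z); apply/funext => z'; exact: IH.
Qed.

Lemma smooth_on_zero_section D (f : TM -> R) : smooth_on (D `*` setT) f ->
  smooth_on D (fun z => f (z, 0)).
Proof.
move=> sf vs z Dz.
have -> : iterD vs (fun z' => f (z', 0)) =
  iterD [seq (v, 0) : TM | v <- vs] f \o (fun z' => (z', 0) : TM).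
  by apply/funext => z'; exact: iterD_zero_section.
apply: differentiable_comp; last by apply: sf.
by apply: differentiable_pair => //; exact: differentiable_cst.
Qed.

End ZeroSectionSmooth.

(** * Functions constant on the surface or on its tangent bundle *)

Section Classes.
Context {R : realType} (S : riemannian_surface R).
Local Notation TM := ((R * R) * (R * R))%type.
Implicit Types (c : chart R S) (q : TM) (F a : tangent S -> R[i])
  (f h : tangent S -> R) (phi : R -> R[i]).

(** Identities in r^2 valid on each fibre are thus identities on the half
    line. *)
Lemma fiber_r2_onto (p : S) (t : R) : 0 <= t ->
  exists u : tangent S, base u = p /\ r2 u = t.
Proof.
move=> t0; have [c [ac cp cc]] := isothermal_cover p.
have ic : isothermal c by [].
have iz : img c (coord c p) by exists p.
have l0 := lambda_gt0 ic iz.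
exists (lift c (coord c p) (Num.sqrt (t / lambda c (coord c p)), 0)).
rewrite r2_lift//=; split; first by rewrite coordK.
rewrite expr0n addr0 sqr_sqrtr; last by rewrite divr_ge0// ltW.
by rewrite mulrC divfK// gt_eqF.
Qed.

Lemma r2_ge0 (u : tangent S) : 0 <= r2 u.
Proof.
have [c [ac cu cc]] := isothermal_cover (base u).
have ic : isothermal c by [].
have [iz eu] := lift_surj ac cu.
by rewrite -eu r2_lift// mulr_ge0 ?addr_ge0 ?sqr_ge0// ltW// lambda_gt0.
Qed.

Lemma basic_frame c F (F0 : S -> R[i]) q : (forall u, F u = F0 (base u)) ->
  [/\ hor c (pull c F) q = d_z (F0 \o param c) q.1,
      horbar c (pull c F) q = d_zbar (F0 \o param c) q.1
    & pd_w (pull c F) q = 0].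
Proof.
move=> hF; have -> : pull c F = (fun y => (F0 \o param c) y.1).
  by apply/funext => y; rewrite /pull hF.
exact: frame_fst.
Qed.

Lemma constant_frame c F q : constant_fun F ->
  [/\ hor c (pull c F) q = 0, horbar c (pull c F) q = 0 & pd_w (pull c F) q = 0].
Proof.
move=> [k Fk]; have := @basic_frame c F (fun=> k) q Fk.
have e v : cderive v ((fun=> k) \o param c) q.1 = 0.
  exact: (is_cderive_cst v q.1 k).2.
by rewrite /d_z /d_zbar !e mulr0 subrr addr0 mul0r.
Qed.

Lemma constant_complexify h : constant_fun h -> constant_fun (complexify h).
Proof. by move=> [k hk]; exists k%:C => u; rewrite /complexify hk. Qed.

Lemma real_d_z_eq0 (f : R * R -> R) z : d_z (fun y => (f y)%:C) z = 0 ->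
  'D_(1 : R, 0 : R) f z = 0 /\ 'D_(0 : R, 1 : R) f z = 0.
Proof.
rewrite /d_z /cderive /= !derive_cst.
move: ('D_(1 : R, 0 : R) f z) ('D_(0 : R, 1 : R) f z) => x y e.
have {}e : x +i* 0 - imag_unit * (y +i* 0) = 0 :> R[i].
  have /eqP := e; rewrite mulf_eq0 invr_eq0 (negPf (@two_neq0 R)) orbF.
  by move=> /eqP.
move: (congr1 (@complex.Re R) e) (congr1 (@complex.Im R) e).
rewrite !Re_addc !Im_addc.
rewrite /imag_unit /=.
rewrite !(mul0r, mulr0, mul1r, subr0, oppr0, addr0, add0r) => -> /eqP.
by rewrite oppr_eq0 => /eqP.
Qed.

Lemma basic_hor_eq0_constant h : basic (complexify h) ->
  (forall c q, isothermal c -> img c q.1 -> hor c (pull c (complexify h)) q = 0) ->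
  constant_fun h.
Proof.
move=> [sh [H0 hH0]] hor0.
have hE u : h u = complex.Re (H0 (base u)) by rewrite -hH0.
have [[p]|nS] := pselect (inhabited S); last first.
  by exists 0 => u; exfalso; apply: nS; exact: inhabits (base u).
exists (complex.Re (H0 p)) => u; rewrite hE.
apply: (@surface_constant _ S (fun p => complex.Re (H0 p))) => c z ic iz.
have [ac _] := ic.
have dh : differentiable ((fun p => complex.Re (H0 p)) \o param c) z.
  have [sr _] := sh c ac.
  have := smooth_on_zero_section sr [::] iz.
  rewrite (_ : (fun _ => _) = (fun p => complex.Re (H0 p)) \o param c)//.
  by apply/funext => y /=; rewrite hE.
split=> // v.
have := hor0 c (z, 0) ic iz.
have hC w : complexify h w = ((fun p => (complex.Re (H0 p))%:C)) (base w).
  by rewrite /complexify hE.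
have [-> _ _] := @basic_frame c (complexify h) (fun p => (complex.Re (H0 p))%:C) (z, 0) hC.
move=> /real_d_z_eq0[e1 e2].
have -> : v = v.1 *: (1 : R, 0 : R) + (v.2 *: (0 : R, 1 : R) + 0).
  case: v => x y; congr (_, _); rewrite /= /GRing.scale /=; ring.
rewrite !deriveDZ//; transitivity (v.1 * 0 + (v.2 * 0 + 0)).
  by congr (_ * _ + (_ * _ + _)); [exact: e1|exact: e2|exact: derive0].
by rewrite !mulr0 !addr0.
Qed.

(** phi'(r^2) lambda wbar = 0 makes phi' vanish at every t > 0, since every such
    t is the square norm of a vector with w <> 0. *)
Lemma radial_pd_w_eq0_constant a : smooth_TM a -> radial a ->
  (forall c q, isothermal c -> img c q.1 -> pd_w (pull c a) q = 0) ->
  constant_fun a.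
Proof.
move=> sa [phi ra] w0; have [[sr si] aphi] := ra.
have [[p]|nS] := pselect (inhabited S); last first.
  by exists 0 => u; exfalso; apply: nS; exact: inhabits (base u).
have d0 t : 0 < t -> half_cderive phi t = 0.
  move=> t0; have [u [bu ru]] := fiber_r2_onto p (ltW t0).
  have [c [ac cu cc]] := isothermal_cover (base u).
  have ic : isothermal c by [].
  have [iz eu] := lift_surj ac cu.
  have := w0 c (coord c (base u), comp u c) ic iz.
  have [_ _ ->] := @frame_radial _ _ c phi a (coord c (base u), comp u c) ic iz sa ra.
  rewrite [lift _ _ _]eu ru => /eqP; rewrite !mulf_eq0 conjc_eq0 => /orP[/orP[/eqP//|]|].
    by rewrite eq_complex /= eqxx andbT gt_eqF// lambda_gt0.
  rewrite cplx_eq0 => /eqP/= wu; have := ru; rewrite -eu r2_lift// wu.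
  by rewrite expr0n addr0 mulr0 => e; rewrite -e ltxx in t0.
have r0 t : 0 < t -> half_derive (fun s => complex.Re (phi s)) t = 0.
  by move=> /d0/(congr1 (@complex.Re R)).
have i0 t : 0 < t -> half_derive (fun s => complex.Im (phi s)) t = 0.
  by move=> /d0/(congr1 (@complex.Im R)).
exists (phi 0) => u; rewrite aphi.
have ru := r2_ge0 u.
apply: complex_ext.
  by rewrite (half_derive_cst_affine sr r0 ru) mul0r add0r.
by rewrite (half_derive_cst_affine si i0 ru) mul0r add0r.
Qed.

Lemma basic_holomorphic a : smooth_TM a ->
  (basic a /\ forall c q, isothermal c -> img c q.1 -> horbar c (pull c a) q = 0) <->
  holomorphic_TM a.
Proof.
move=> sa; split.
  move=> [[_ [F0 aF0]] hb]; exists F0 => // c ic; have [ac _] := ic.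
  split.
    have e : F0 \o param c = fun z => pull c a (z, 0).
      by apply/funext => z; rewrite /pull aF0.
    rewrite e; have [sr si] := sa c ac.
    by split; [exact: (smooth_on_zero_section sr)|exact: (smooth_on_zero_section si)].
  move=> z iz; have := hb c (z, 0) ic iz.
  by have [_ -> _] := @basic_frame c a F0 (z, 0) aF0.
move=> [F0 hF0 aF0]; split; first by split=> //; exists F0.
move=> c q ic iq; have [_ -> _] := @basic_frame c a F0 q aF0.
by have [_] := hF0 c ic; apply.
Qed.

End Classes.

(** * The two equations for each pair of classes *)

Lemma conj_cplx0 (R : realType) : conjc (cplx (0 : R * R)) = 0.
Proof. exact: conjc0. Qed.

Lemma curvature_term_complex (R : realType) (l k t : R) :
  (l * k / 2%:R * t)%:C = l%:C * k%:C / 2%:R * t%:C.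
Proof.
by apply: complex_ext; rewrite !(Re_mulc, Im_mulc) /=; field.
Qed.

Lemma solve_curvature (R : realType) (l k t : R) (d w : R[i]) :
  l != 0 -> t != 0 -> w != 0 ->
  d * l%:C * w = - (w * (l * k / 2%:R * t)%:C) <-> k%:C = - (2%:R * d / t%:C).
Proof.
move=> l0 t0 w0; rewrite curvature_term_complex.
have l0' : l%:C != 0 by rewrite eq_complex /= eqxx andbT.
have t0' : t%:C != 0 by rewrite eq_complex /= eqxx andbT.
split=> [eq|->]; last by field.
have lw0 : l%:C * w != 0 by rewrite mulf_neq0.
have -> : d = - (k%:C / 2%:R * t%:C).
  by apply: (mulIf lw0); rewrite mulrA eq; ring.
by field.
Qed.

Lemma curvature_parts (R : realType) (k x y m : R) : m != 0 ->
  k%:C = - (2%:R * (x +i* y) / m%:C) <-> k * m + 2%:R * x = 0 /\ y = 0.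
Proof.
move=> m0; have m0' : m%:C != 0 by rewrite eq_complex /= eqxx andbT.
split=> [eq|[eq ->]].
  have {}eq : k%:C * m%:C + 2%:R * (x +i* y) = 0.
    by rewrite eq; move: (x +i* y) (m%:C) m0' => z m' m0'; field.
  move: (congr1 (@complex.Re R) eq) (congr1 (@complex.Im R) eq).
  rewrite !(Re_addc, Im_addc, Re_mulc, Im_mulc) /= => e1 e2.
  by split; lra.
apply: (mulIf m0').
have -> : - (2%:R * (x +i* 0) / m%:C) * m%:C = - (2%:R * (x +i* 0)).
  by move: (x +i* 0) (m%:C) m0' => z m' m0'; field.
by apply: complex_ext; rewrite -mulrN !(Re_mulc, Im_mulc) /=; lra.
Qed.

Section KahlerEquations.
Context {R : realType} (S : riemannian_surface R) (K : S -> R).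
Variables (f h : tangent S -> R) (a : tangent S -> R[i]).
Local Notation TM := ((R * R) * (R * R))%type.
Implicit Types (c : chart R S) (q : TM).
Hypotheses (hK : gauss_curvature K)
    (smooth_f : smooth_TM (complexify f))
    (smooth_a : smooth_TM a)
    (smooth_h : smooth_TM (complexify h))
    (posdef : ciconia_posdef f a h).

(** No component of the differential along dz ^ eta ^ etabar. *)
Definition hor_eq : Prop := forall c q, isothermal c -> img c q.1 ->
  hor c (pull c (complexify h)) q = pd_w (pull c a) q.

Definition curvature_term c q : R :=
  lambda c q.1 * K (param c q.1) / 2%:R * h (lift c q.1 q.2).

(** No component of the differential along dz ^ dzbar ^ eta. *)
Definition vert_eq : Prop := forall c q, isothermal c -> img c q.1 ->
  pd_w (pull c (complexify f)) q =
  conjc (horbar c (pull c a) q) - conjc (cplx q.2) * (curvature_term c q)%:C.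

(** What is left of [vert_eq] once the derivative of [a] has been separated. *)
Definition fiber_eq : Prop := forall c q, isothermal c -> img c q.1 ->
  pd_w (pull c (complexify f)) q = - (conjc (cplx q.2) * (curvature_term c q)%:C).

Lemma kahler_equations : ciconia_kahler f a h <-> hor_eq /\ vert_eq.
Proof.
have crit c q := @ext_ciconia_form_eq0 _ _ K f h a hK smooth_f smooth_a smooth_h c q.
split.
  move=> [_ d0]; split=> c q ic iq; have := (crit c q ic iq).1 (d0 c q ic iq);
  by case.
move=> [hA hB]; split=> // c q ic iq; apply/(crit c q ic iq).
by split; [exact: hA|exact: hB].
Qed.

Lemma hor_eq_basic_basic : basic (complexify h) -> basic a ->
  hor_eq <-> constant_fun h.
Proof.
move=> bh [_ [A0 hA]]; split=> [hA0|ch c q ic iq].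
  apply: basic_hor_eq0_constant => // c q ic iq; rewrite hA0//.
  by have [_ _ ->] := basic_frame c q hA.
have [-> _ _] := constant_frame c q (constant_complexify ch).
by have [_ _ ->] := basic_frame c q hA.
Qed.

(** The left-hand side is constant along fibres and the right-hand side vanishes
    on the zero section, so both vanish everywhere. *)
Lemma hor_eq_basic_radial : basic (complexify h) -> radial a ->
  hor_eq <-> constant_fun h /\ constant_fun a.
Proof.
move=> bh ra; have [phi pa] := ra; split=> [hA0|[ch ca] c q ic iq].
  have ch : constant_fun h.
    apply: basic_hor_eq0_constant => // c q ic iq.
    have [_ [H0 hH]] := bh; have [-> _ _] := basic_frame c q hH.
    have := hA0 c (q.1, 0) ic iq; have [-> _ _] := basic_frame c (q.1, 0) hH.
    have [_ _ ->] := frame_radial ic (iq : img c (q.1, 0 : R * R).1) smooth_a pa.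
    by rewrite [conjc (cplx _)]conj_cplx0 mulr0.
  split=> //; apply: radial_pd_w_eq0_constant => // c q ic iq; rewrite -hA0//.
  by have [-> _ _] := constant_frame c q (constant_complexify ch).
have [-> _ _] := constant_frame c q (constant_complexify ch).
by have [_ _ ->] := constant_frame c q ca.
Qed.

Lemma hor_eq_radial_basic : radial (complexify h) -> basic a -> hor_eq.
Proof.
move=> [psi ph] [_ [A0 hA]] c q ic iq.
have [-> _ _] := frame_radial ic iq smooth_h ph.
by have [_ _ ->] := basic_frame c q hA.
Qed.

Lemma hor_eq_radial_radial : radial (complexify h) -> radial a ->
  hor_eq <-> constant_fun a.
Proof.
move=> [psi ph] ra; split=> [hA0|ca c q ic iq].
  apply: radial_pd_w_eq0_constant => // c q ic iq; rewrite -hA0//.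
  by have [-> _ _] := frame_radial ic iq smooth_h ph.
have [-> _ _] := frame_radial ic iq smooth_h ph.
by have [_ _ ->] := constant_frame c q ca.
Qed.

Lemma pd_w_zero_section F : smooth_TM F -> basic F \/ radial F ->
  forall c z, isothermal c -> img c z -> pd_w (pull c F) (z, 0) = 0.
Proof.
move=> sF [[_ [F0 hF]]|[phi pF]] c z ic iz.
  by have [_ _ ->] := basic_frame c (z, 0) hF.
have [_ _ ->] := frame_radial ic (iz : img c (z, 0 : R * R).1) sF pF.
by rewrite [conjc (cplx _)]conj_cplx0 mulr0.
Qed.

(** At w = 0 the equation is conj (a_1bar) = 0, and a_1bar is constant along
    fibres. *)
Lemma vert_eq_basic : basic (complexify f) \/ radial (complexify f) -> basic a ->
  vert_eq <-> fiber_eq /\ holomorphic_TM a.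
Proof.
move=> cf ba; have [_ [A0 hA]] := ba; split=> [hB|[hV ha] c q ic iq].
  have hb c q : isothermal c -> img c q.1 -> horbar c (pull c a) q = 0.
    move=> ic iq; have [_ -> _] := basic_frame c q hA.
    have := hB c (q.1, 0) ic iq; rewrite pd_w_zero_section// [conjc (cplx _)]conj_cplx0 mul0r subr0.
    have [_ -> _] := basic_frame c (q.1, 0) hA.
    by move=> /esym/eqP; rewrite conjc_eq0 => /eqP.
  split; last by apply/basic_holomorphic.
  by move=> c q ic iq; rewrite hB// hb// conjc0 sub0r.
have [_ hb] := (basic_holomorphic smooth_a).2 ha.
by rewrite hV// hb// conjc0 sub0r.
Qed.

Lemma vert_eq_radial : radial a -> vert_eq <-> fiber_eq.
Proof.
move=> [phi pa]; split=> e c q ic iq; rewrite e//.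
  by have [_ -> _] := frame_radial ic iq smooth_a pa; rewrite conjc0 sub0r.
by have [_ -> _] := frame_radial ic iq smooth_a pa; rewrite conjc0 sub0r.
Qed.

Hypothesis h_gt0 : forall u, 0 < h u.

Lemma fiber_eq_basic : basic (complexify f) -> fiber_eq <-> forall p, K p = 0.
Proof.
move=> [_ [F0 hF]]; split=> [hV p|K0 c q ic iq].
  have [c [ac cp cc]] := isothermal_cover p; have ic : isothermal c by [].
  have iz : img c (coord c p) by exists p.
  have l0 := lambda_gt0 ic iz.
  have := hV c (coord c p, (1, 0)) ic iz.
  have [_ _ ->] := basic_frame c (coord c p, (1, 0)) hF.
  have -> : cplx (coord c p, (1 : R, 0 : R)).2 = 1 by [].
  rewrite conjc1 mul1r /curvature_term /= coordK// => /esym/eqP.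
  have h0 := h_gt0 (lift c (coord c p) (1, 0)).
  rewrite oppr_eq0 eq_complex /= eqxx andbT !mulf_eq0 invr_eq0 pnatr_eq0 /=.
  by rewrite (gt_eqF l0) (gt_eqF h0) !orbF => /eqP.
have [_ _ ->] := basic_frame c q hF.
by rewrite /curvature_term K0 mulr0 !mul0r mulr0 oppr0.
Qed.

(** Division by lambda wbar h, which is why zero vectors are excluded. *)
Lemma fiber_eq_radial phi : radial_by phi (complexify f) ->
  fiber_eq <-> forall u, 0 < r2 u ->
    (K (base u))%:C = - (2%:R * half_cderive phi (r2 u) / (h u)%:C).
Proof.
move=> pf; split=> [hV u ru|e c q ic iq].
  have [c [ac cu cc]] := isothermal_cover (base u); have ic : isothermal c by [].
  have [iz eu] := lift_surj ac cu.
  have := hV c (coord c (base u), comp u c) ic iz.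
  have [_ _ ->] := @frame_radial _ _ c phi _ (coord c (base u), comp u c) ic iz smooth_f pf.
  rewrite /curvature_term [lift _ _ _]eu [param _ _](coordK cu).
  have l0 := lambda_gt0 ic iz; have h0 := h_gt0 u.
  have w0 : conjc (cplx (comp u c)) != 0.
    rewrite conjc_eq0 cplx_eq0; apply: contraTneq ru => w0.
    by rewrite -eu r2_lift// w0 expr0n addr0 mulr0 ltxx.
  by move=> /solve_curvature; apply=> //; rewrite gt_eqF.
have l0 := lambda_gt0 ic iq; have h0 := h_gt0 (lift c q.1 q.2).
have [_ _ ->] := frame_radial ic iq smooth_f pf.
have [q0|q0] := eqVneq q.2 0.
  by rewrite q0 [conjc (cplx _)]conj_cplx0 mulr0 mul0r oppr0.
have w0 : conjc (cplx q.2) != 0.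
  by rewrite conjc_eq0 cplx_eq0.
apply/solve_curvature => //; rewrite ?gt_eqF//.
apply: (e (lift c q.1 q.2)); rewrite r2_lift//; by apply: mulr_gt0 => //; exact: sqr_norm_gt0.
Qed.

(** K is constant along the fibre while phi' and h = psi(r^2) are continuous in
    r^2 up to 0, so the identity extends to zero vectors. *)
Lemma fiber_eq_radial_radial phi :
  radial_by phi (complexify f) -> radial (complexify h) ->
  fiber_eq <-> forall u,
    (K (base u))%:C = - (2%:R * half_cderive phi (r2 u) / (h u)%:C).
Proof.
move=> pf [psi [[sr _] hpsi]]; split; last first.
  by move=> e; apply/(fiber_eq_radial pf) => u _; exact: e.
move=> /(fiber_eq_radial pf) e u.
have [/e//|r0] := ltP 0 (r2 u).
have {r0} r0 : r2 u = 0 by apply/eqP; rewrite eq_le r0 r2_ge0.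
have [[sfr sfi] _] := pf.
have hE u' : h u' = complex.Re (psi (r2 u')) by rewrite -hpsi.
have h0 := h_gt0 u.
have key t : 0 < t ->
  K (base u) * complex.Re (psi t) + 2%:R * half_derive (fun s => complex.Re (phi s)) t = 0
  /\ half_derive (fun s => complex.Im (phi s)) t = 0.
  move=> t0; have [u' [bu ru]] := fiber_r2_onto (base u) (ltW t0).
  have hu' := h_gt0 u'.
  have := e u'; rewrite ru bu => /(_ t0).
  rewrite -[complex.Re (psi t)](_ : h u' = _); last by rewrite hE ru.
  by move=> /curvature_parts; apply; rewrite gt_eqF.
have i0 : half_derive (fun s => complex.Im (phi s)) 0 = 0.
  by apply: eq0_cvg0 => [|t /key[]//]; exact: half_derive_cvg0.
have k0 : K (base u) * complex.Re (psi 0) +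
    2%:R * half_derive (fun s => complex.Re (phi s)) 0 = 0.
  apply: (@eq0_cvg0 _ (fun t => K (base u) * complex.Re (psi t) +
    2%:R * half_derive (fun s => complex.Re (phi s)) t)); last by move=> t /key[].
  apply: cvgD; apply: cvgM; try exact: cvg_cst.
    exact: half_smooth_cvg0 sr.
  exact: half_derive_cvg0.
move: k0; rewrite r0 -[complex.Re (psi 0)](_ : h u = _); last by rewrite hE r0.
by move=> k0; apply/curvature_parts; rewrite ?gt_eqF.
Qed.

(** With h constant, phi'(t) = - K(p) h / 2 for all p and all t > 0, so both sides
    are constant. *)
Lemma fiber_eq_affine : radial (complexify f) -> constant_fun h ->
  fiber_eq <-> exists f1 f0 h0 : R,
    [/\ forall u, f u = f1 * r2 u + f0, forall u, h u = h0
      & forall p, K p = - (2%:R * f1 / h0)].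
Proof.
move=> [phi pf] [m hm]; have [[sr si] fphi] := pf.
have fE u : f u = complex.Re (phi (r2 u)) by rewrite -fphi.
have imE (u : tangent S) : complex.Im (phi (r2 u)) = 0 by rewrite -fphi.
split.
  move=> /(fiber_eq_radial pf) e.
  have [[p0]|nS] := pselect (inhabited S); last first.
    (* Without points every identity is vacuous. *)
    by exists 0, 0, 0; split=> [u|u|p]; exfalso; apply: nS;
      [exact: inhabits (base u)|exact: inhabits (base u)|exact: inhabits p].
  have key p t : 0 < t ->
      m != 0 /\ K p * m + 2%:R * half_derive (fun s => complex.Re (phi s)) t = 0.
    move=> t0; have [u [bu ru]] := fiber_r2_onto p (ltW t0).
    have m0 : m != 0 by rewrite -(hm u) gt_eqF.
    have := e u; rewrite ru bu hm => /(_ t0).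
    by move=> /curvature_parts; case.
  have [m0 _] := key p0 1 ltr01.
  exists (- (K p0 * m / 2%:R)), (complex.Re (phi 0)), m; split=> // [u|p].
    rewrite fE; apply: (half_derive_cst_affine sr _ (r2_ge0 u)) => t t0.
    by have [_] := key p0 t t0; lra.
  have [_ e1] := key p 1 ltr01; have [_ e2] := key p0 1 ltr01.
  apply: (mulIf m0); rewrite mulNr divfK//.
  move: (half_derive _ _) e1 e2 => x; lra.
move=> [f1 [f0 [h0 [ff fh Kp]]]]; apply/(fiber_eq_radial pf) => u ru.
have m0 : h0 != 0 by rewrite -(fh u) gt_eqF.
rewrite fh; apply/curvature_parts => //; split.
  rewrite Kp (@half_derive_affine _ _ f1 f0)//; first by field.
  by move=> s s0; have [v [_ <-]] := fiber_r2_onto (base u) s0; rewrite -fE ff.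
rewrite (@half_derive_affine _ _ 0 0)//.
by move=> s s0; have [v [_ <-]] := fiber_r2_onto (base u) s0; rewrite imE mul0r addr0.
Qed.

End KahlerEquations.

(** * The classification *)

Theorem theorem2p1 (R : realType) (S : riemannian_surface R) (K : S -> R)
    (f h : tangent S -> R) (a : tangent S -> R[i])
    (hK : gauss_curvature K)
    (smooth_f : smooth_TM (complexify f))
    (smooth_a : smooth_TM a)
    (smooth_h : smooth_TM (complexify h))
    (posdef : ciconia_posdef f a h) :
  (* (i) *)
  (basic (complexify f) -> basic a -> basic (complexify h) ->
    (ciconia_kahler f a h <->
      [/\ forall p, K p = 0, holomorphic_TM a & constant_fun h])) /\
  (* (ii) *)
  (basic (complexify f) -> radial a -> basic (complexify h) ->
    (ciconia_kahler f a h <->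
      [/\ forall p, K p = 0, constant_fun a & constant_fun h])) /\
  (* (iii) *)
  (basic (complexify f) -> basic a -> radial (complexify h) ->
    (ciconia_kahler f a h <->
      (forall p, K p = 0) /\ holomorphic_TM a)) /\
  (* (iv) *)
  (radial (complexify f) -> basic a -> basic (complexify h) ->
    (ciconia_kahler f a h <->
      (exists f1 f0 h0 : R,
        [/\ forall u, f u = f1 * r2 u + f0,
            forall u, h u = h0
          & forall p, K p = - (2%:R * f1 / h0)]) /\
      holomorphic_TM a)) /\
  (* (v) *)
  (basic (complexify f) -> radial a -> radial (complexify h) ->
    (ciconia_kahler f a h <->
      (forall p, K p = 0) /\ constant_fun a)) /\
  (* (vi) *)
  (forall phi : R -> R[i],
    radial_by phi (complexify f) -> basic a -> radial (complexify h) ->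
    (ciconia_kahler f a h <->
      (forall u, (K (base u))%:C =
         - (2%:R * half_cderive phi (r2 u) / (h u)%:C)) /\
      holomorphic_TM a)) /\
  (* (vii) *)
  (radial (complexify f) -> radial a -> basic (complexify h) ->
    (ciconia_kahler f a h <->
      (exists f1 f0 h0 : R,
        [/\ forall u, f u = f1 * r2 u + f0,
            forall u, h u = h0
          & forall p, K p = - (2%:R * f1 / h0)]) /\
      constant_fun a)) /\
  (* (viii) *)
  (forall phi : R -> R[i],
    radial_by phi (complexify f) -> radial a -> radial (complexify h) ->
    (ciconia_kahler f a h <->
      (forall u, (K (base u))%:C =
         - (2%:R * half_cderive phi (r2 u) / (h u)%:C)) /\
      constant_fun a)).
Proof.
have kE := kahler_equations hK smooth_f smooth_a smooth_h posdef.
have h_gt0 u : 0 < h u := posdef_h_gt0 u posdef.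
split; [|split; [|split; [|split; [|split; [|split; [|split]]]]]].
- move=> bf ba bh; rewrite kE (hor_eq_basic_basic bh ba).
  rewrite (vert_eq_basic K h smooth_f smooth_a (or_introl bf) ba).
  by rewrite (fiber_eq_basic K h_gt0 bf); split=> [[? []]|[]].
- move=> bf ra bh; rewrite kE (hor_eq_basic_radial smooth_a bh ra).
  rewrite (vert_eq_radial K f h smooth_a ra) (fiber_eq_basic K h_gt0 bf).
  by split=> [[[]]|[]].
- move=> bf ba rh; rewrite kE.
  rewrite (vert_eq_basic K h smooth_f smooth_a (or_introl bf) ba).
  rewrite (fiber_eq_basic K h_gt0 bf).
  by split=> [[]//|?]; split=> //; exact: hor_eq_radial_basic.
- move=> rf ba bh; rewrite kE (hor_eq_basic_basic bh ba).
  rewrite (vert_eq_basic K h smooth_f smooth_a (or_intror rf) ba).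
  split=> [[ch [/(fiber_eq_affine K smooth_f h_gt0 rf ch)]]|[ex ha]]//.
  have ch : constant_fun h by case: ex => _ [_ [m [_ hm _]]]; exists m.
  by split=> //; split=> //; apply/fiber_eq_affine.
- move=> bf ra rh; rewrite kE (hor_eq_radial_radial smooth_a smooth_h rh ra).
  rewrite (vert_eq_radial K f h smooth_a ra) (fiber_eq_basic K h_gt0 bf).
  by split=> -[].
- move=> phi pf ba rh; have rf : radial (complexify f) by exists phi.
  rewrite kE (vert_eq_basic K h smooth_f smooth_a (or_intror rf) ba).
  rewrite (fiber_eq_radial_radial K smooth_f h_gt0 pf rh).
  by split=> [[]//|?]; split=> //; exact: hor_eq_radial_basic.
- move=> rf ra bh; rewrite kE (hor_eq_basic_radial smooth_a bh ra).
  rewrite (vert_eq_radial K f h smooth_a ra).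
  split=> [[[ch ca] /(fiber_eq_affine K smooth_f h_gt0 rf ch)]|[ex ca]]//.
  have ch : constant_fun h by case: ex => _ [_ [m [_ hm _]]]; exists m.
  by split=> //; apply/fiber_eq_affine.
- move=> phi pf ra rh; rewrite kE (hor_eq_radial_radial smooth_a smooth_h rh ra).
  rewrite (vert_eq_radial K f h smooth_a ra).
  rewrite (fiber_eq_radial_radial K smooth_f h_gt0 pf rh).
  by split=> -[].
Qed.
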